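(* Let $M$ be an $R$-module, $(t_n)_{n\ge1}$ a Markov trace on $(\widetilde{BMW}_n)_{n\ge1}$ with values in $M$, let $\overline{S}=S/(a^2-y^2)$, $N=M\otimes_R\overline{S}[(a^2-y)^{-1}]$, and let $t'_n$ be the composite of $t_n$ with the natural map $M\to N$. Then $(t'_n)$ is a linear combination of $(t_n^H)$ and $(t_n^K)$: there exist $m_1,m_2\in N$ such that $t'_n(\beta)=t_n^H(\beta)\,m_1+t_n^K(\beta)\,m_2$ for all $n\ge 1$ and all $\beta\in\widetilde{BMW}_n$.
   Context: $R=\mathbb{Q}[a,b,c,(abc)^{-1}]$, $x=b+c$, $y=bc$, $S=R[x^{-1}]$, $S_{\pm}=S/(a\mp y)$. $H_n$ is the quotient of the group algebra $RB_n$ of the braid group (Artin generators $s_1,\dots,s_{n-1}$) by the relations $(s_i-a)(s_i-b)(s_i-c)=0$. $\widetilde{BMW}_n$ is the quotient of $H_n$ by the two-sided ideal generated by $$\mathcal{R}_i=-y\,s_is_{i+1}^{-1}s_i+y^2s_{i+1}^{-1}s_is_{i+1}^{-1}-s_is_{i+1}s_i-xy^2s_{i+1}^{-2}+x\,s_i^2+y^3s_{i+1}^{-1}s_i^{-1}s_{i+1}^{-1},\quad 1\le i\le n-2.$$ A Markov trace on a tower of algebras $(A_n)_{n\ge1}$ that are quotients of the group algebras of $B_n$, with values in a module $M$, is a sequence of linear maps $t_n:A_n\to M$ with $t_n(uv)=t_n(vu)$ and $t_{n+1}(\iota_n(u)s_n^{\pm1})=t_n(u)$ for all $u,v\in A_n$,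 where $\iota_n:A_n\to A_{n+1}$ is $s_i\mapsto s_i$. $(t_n^H)$ is the Ocneanu trace: let $\mathcal{H}_n(b,c)$ be the quotient of $RB_n$ by $(s_i-b)(s_i-c)=0$; $H_n\to\mathcal{H}_n(b,c)$ factors through $\widetilde{BMW}_n$, and $t_n^H:\widetilde{BMW}_n\to S$ is the Markov trace factoring through $(\mathcal{H}_n(b,c))$ with $t_1^H(1)=1$ (it classically exists and is unique). In the statement it is composed with $S\to\overline S$. $BMW_n^{\pm}$ is the quotient of $H_n\otimes_R S_{\pm}$ by the two-sided ideal generated by $e_1s_2e_1-e_1$ and $e_1s_2^{-1}e_1-e_1$ (no relation for $n\le2$), where $e_1=\frac{as_1^{-1}\pm s_1}{x}\mp1$; it is a quotient of $\widetilde{BMW}_n\otimes_R S_\pm$. The Kauffman trace $t_n^{\pm}:BMW_n^{\pm}\to S_{\pm}$ is the Markov trace given on braids by the Kauffman polynomial (original or Dubrovnik version) of the closure; it is the unique Markov trace on $(BMW_n^{\pm})$ with values in $S_\pm$ satisfying $t_1^{\pm}(1)=1$ and $t_2^{\pm}(1)=\frac{y\mp x+1}{x}$ (its existence is classical). $t_n^K:\widetilde{BMW}_n\to\overline{S}$ is the Markov trace obtained from $(t_n^+,t_n^-)$ via the Chinese Remainder isomorphism $\overline{S}\simeq S_+\oplus S_-$. *)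

(* Defs.v *)
From HB Require Import structures.
From mathcomp Require Import all_boot all_algebra finmap boolp monalg ring.

Set Implicit Arguments.
Unset Strict Implicit.
Unset Printing Implicit Defensive.
Import GRing.Theory.
Local Open Scope ring_scope.
Local Open Scope quotient_scope.

(* MathComp's algType requires 1 != 0, which is not known a priori for algebras
   given by generators and relations; hence this variant over possibly trivial
   rings: an algebra is a ring with a ring morphism from K into its center. *)
HB.mixin Record PzRing_isPzAlgebra (K : comPzRingType) A of GRing.PzRing A := {
  palg : K -> A;
  palg_zmod : zmod_morphism palg;
  palg_monoid : monoid_morphism palg;
  palgC : forall k (u : A), palg k * u = u * palg k
}.
#[short(type="pzAlgType")]
HB.structure Definition PzAlgebra (K : comPzRingType) :=
  {A of GRing.PzRing A & PzRing_isPzAlgebra K A}.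
Arguments palg {K s}.
HB.instance Definition _ (K : comPzRingType) (A : pzAlgType K) :=
  GRing.isZmodMorphism.Build K A palg palg_zmod.
HB.instance Definition _ (K : comPzRingType) (A : pzAlgType K) :=
  GRing.isMonoidMorphism.Build K A palg palg_monoid.

(* Restriction of scalars along f. *)
Definition restr (K L : pzRingType) (f : {rmorphism K -> L}) (V : lmodType L) :
  Type := V.

Section Restr.
Variables (K L : pzRingType) (f : {rmorphism K -> L}) (V : lmodType L).
HB.instance Definition _ := GRing.Zmodule.on (restr f V).

Definition restr_scale (k : K) (v : restr f V) : restr f V := f k *: (v : V).

Fact restr_scaleA k l v : restr_scale k (restr_scale l v) = restr_scale (k * l) v.
Proof. by rewrite /restr_scale scalerA rmorphM. Qed.
Fact restr_scale1 : left_id 1 restr_scale.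
Proof. by move=> v; rewrite /restr_scale rmorph1 scale1r. Qed.
Fact restr_scaleDr : right_distributive restr_scale +%R.
Proof. by move=> k u v; apply: scalerDr. Qed.
Fact restr_scaleDl v : {morph restr_scale^~ v : k l / k + l}.
Proof. by move=> k l; rewrite /restr_scale rmorphD scalerDl. Qed.
HB.instance Definition _ := GRing.Zmodule_isLmodule.Build K (restr f V)
  restr_scaleA restr_scale1 restr_scaleDr restr_scaleDl.
End Restr.

Definition amod (K : comPzRingType) (A : pzAlgType K) : lmodType K :=
  restr (palg : {rmorphism K -> A}) A^o.

Lemma amod_scaleE (K : comPzRingType) (A : pzAlgType K) k (u : amod A) :
  k *: u = palg k * (u : A).
Proof. by []. Qed.

Section Quot.
Variable A : pzRingType.

Inductive ideal (X : A -> Prop) : A -> Prop :=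
| ideal_gen u of X u : ideal X u
| ideal0 : ideal X 0
| idealD u v of ideal X u & ideal X v : ideal X (u + v)
| idealMl u v of ideal X v : ideal X (u * v)
| idealMr u v of ideal X u : ideal X (u * v).

Variable X : A -> Prop.
Definition ideal_pred : {pred A} := [pred u | `[< ideal X u >]].

Fact ideal_zmod_closed : zmod_closed ideal_pred.
Proof.
split=> [|u v /asboolP Xu /asboolP Xv]; apply/asboolP; first exact: ideal0.
by apply: idealD Xu _; rewrite -mulN1r; apply: idealMl.
Qed.
HB.instance Definition _ := GRing.isZmodClosed.Build A ideal_pred ideal_zmod_closed.

(* A / (X), with (X) the two-sided ideal generated by X *)
Definition quot : Type := Quotient.quot ideal_pred.
HB.instance Definition _ := GRing.Zmodule.on quot.

Definition quot_pi (u : A) : quot := \pi_(Quotient.quot ideal_pred) u.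
Definition quot_repr (u : quot) : A := repr (u : Quotient.quot ideal_pred).

Lemma quot_reprK : cancel quot_repr quot_pi.
Proof. exact: reprK. Qed.

Lemma quot_eqP u v : quot_pi u = quot_pi v <-> ideal X (u - v).
Proof.
split=> [/eqP|Iuv]; first by rewrite /quot_pi -Quotient.idealrBE => /asboolP.
by apply/eqP; rewrite /quot_pi -Quotient.idealrBE; apply/asboolP.
Qed.

Lemma quot_ind (P : quot -> Prop) : (forall u, P (quot_pi u)) -> forall u, P u.
Proof. by move=> Ppi u; rewrite -[u]quot_reprK. Qed.

Fact quot_pi_zmod : zmod_morphism quot_pi.
Proof. by move=> u v; rewrite /quot_pi !piE. Qed.
HB.instance Definition _ := GRing.isZmodMorphism.Build A quot quot_pi quot_pi_zmod.

Definition quot_mul (u v : quot) : quot := quot_pi (quot_repr u * quot_repr v).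

Lemma quot_mulE u v : quot_mul (quot_pi u) (quot_pi v) = quot_pi (u * v).
Proof.
set u' := quot_repr (quot_pi u); set v' := quot_repr (quot_pi v).
apply/quot_eqP; rewrite -/u' -/v' -[_ - _](subrKA (u * v')).
rewrite -mulrBl -mulrBr.
by apply: idealD; [apply: idealMr|apply: idealMl];
  apply/quot_eqP; rewrite quot_reprK.
Qed.

Fact quot_mulA : associative quot_mul.
Proof.
elim/quot_ind=> u; elim/quot_ind=> v; elim/quot_ind=> w.
by rewrite !quot_mulE mulrA.
Qed.
Fact quot_mul1r : left_id (quot_pi 1) quot_mul.
Proof. by elim/quot_ind=> u; rewrite quot_mulE mul1r. Qed.
Fact quot_mulr1 : right_id (quot_pi 1) quot_mul.
Proof. by elim/quot_ind=> u; rewrite quot_mulE mulr1. Qed.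
Fact quot_mulDl : left_distributive quot_mul +%R.
Proof.
elim/quot_ind=> u; elim/quot_ind=> v; elim/quot_ind=> w.
by rewrite -raddfD !quot_mulE -raddfD mulrDl.
Qed.
Fact quot_mulDr : right_distributive quot_mul +%R.
Proof.
elim/quot_ind=> u; elim/quot_ind=> v; elim/quot_ind=> w.
by rewrite -raddfD !quot_mulE -raddfD mulrDr.
Qed.
HB.instance Definition _ := GRing.Zmodule_isPzRing.Build quot
  quot_mulA quot_mul1r quot_mulr1 quot_mulDl quot_mulDr.

Fact quot_pi_monoid : monoid_morphism quot_pi.
Proof. by split=> // u v; rewrite -quot_mulE. Qed.
HB.instance Definition _ :=
  GRing.isMonoidMorphism.Build A quot quot_pi quot_pi_monoid.
End Quot.
Arguments quot {A} X.
Arguments quot_pi {A} X u.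

Section QuotCom.
Variables (A : comPzRingType) (X : A -> Prop).
Fact quot_mulC : commutative (@GRing.mul (quot X)).
Proof.
by elim/quot_ind=> u; elim/quot_ind=> v; rewrite -!rmorphM mulrC.
Qed.
HB.instance Definition _ :=
  GRing.PzRing_hasCommutativeMul.Build (quot X) quot_mulC.
End QuotCom.

Section QuotAlg.
Variables (K : comPzRingType) (A : pzAlgType K) (X : A -> Prop).
Definition quot_palg (k : K) : quot X := quot_pi X (palg k).
Fact quot_palg_zmod : zmod_morphism quot_palg.
Proof. by move=> k l; rewrite /quot_palg !rmorphB. Qed.
Fact quot_palg_monoid : monoid_morphism quot_palg.
Proof.
by split=> [|k l]; rewrite /quot_palg ?rmorph1 // !rmorphM.
Qed.
Fact quot_palgC k (u : quot X) : quot_palg k * u = u * quot_palg k.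
Proof. by elim/quot_ind: u => u; rewrite -!rmorphM palgC. Qed.
HB.instance Definition _ := PzRing_isPzAlgebra.Build K (quot X)
  quot_palg_zmod quot_palg_monoid quot_palgC.
End QuotAlg.

(* The map A / (X) -> B / (Y) induced by f, when f maps X into (Y). *)
Definition quot_map (A B : pzRingType) (X : A -> Prop) (Y : B -> Prop)
  (f : A -> B) (u : quot X) : quot Y := quot_pi Y (f (quot_repr u)).

Lemma quot_mapE (A B : pzRingType) (X : A -> Prop) (Y : B -> Prop)
    (f : {rmorphism A -> B}) (u : A) :
  (forall v, X v -> ideal Y (f v)) ->
  quot_map Y f (quot_pi X u) = quot_pi Y (f u).
Proof.
move=> fX; apply/quot_eqP; rewrite -rmorphB.
have: ideal X (quot_repr (quot_pi X u) - u) by apply/quot_eqP/quot_reprK.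
elim=> [v /fX //||v w _ IHv _ IHw|v w _ IHw|v w _ IHv].
- by rewrite rmorph0; apply: ideal0.
- by rewrite rmorphD; apply: idealD.
- by rewrite rmorphM; apply: idealMl.
- by rewrite rmorphM; apply: idealMr.
Qed.

Section Loc.
Variables (A : comPzRingType) (s : A).

Definition loc_eqv (p q : A * nat) :=
  `[< exists k, s ^+ (k + q.2) * p.1 = s ^+ (k + p.2) * q.1 >].

Fact loc_eqv_class : equiv_class_of loc_eqv.
Proof.
split=> [p|p q|q p r].
- by apply/asboolP; exists 0%N.
- by apply/asboolP/asboolP => -[k e]; exists k.
case/asboolP=> k e /asboolP[l e']; apply/asboolP; exists (k + l + q.2)%N.
have -> : (k + l + q.2 + r.2 = (l + r.2) + (k + q.2))%N by ring.
have -> : (k + l + q.2 + p.2 = (k + p.2) + (l + q.2))%N by ring.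
by rewrite exprD -mulrA e mulrCA e' mulrA -exprD.
Qed.
Canonical loc_equiv := EquivRelPack loc_eqv_class.

(* A[1/s]; frac p i stands for p / s ^ i *)
Definition loc : Type := {eq_quot loc_eqv}.
HB.instance Definition _ := Choice.on loc.
Definition frac (p : A) (i : nat) : loc := \pi_({eq_quot loc_eqv}) (p, i).
Definition loc_repr (u : loc) : A * nat := repr (u : {eq_quot loc_eqv}).

Lemma loc_reprK u : frac (loc_repr u).1 (loc_repr u).2 = u.
Proof. by rewrite /frac -surjective_pairing; apply: reprK. Qed.

Lemma frac_eqP p i q j :
  frac p i = frac q j <-> exists k, s ^+ (k + j) * p = s ^+ (k + i) * q.
Proof. by split=> [/eqmodP/asboolP|e]; last exact/eqmodP/asboolP. Qed.

Lemma loc_ind (P : loc -> Prop) : (forall p i, P (frac p i)) -> forall u, P u.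
Proof. by move=> Pfrac u; rewrite -[u]loc_reprK. Qed.

Definition loc_add (u v : loc) : loc :=
  let (p, i) := loc_repr u in let (q, j) := loc_repr v in
  frac (s ^+ j * p + s ^+ i * q) (i + j).
Definition loc_opp (u : loc) : loc := let (p, i) := loc_repr u in frac (- p) i.
Definition loc_mul (u v : loc) : loc :=
  let (p, i) := loc_repr u in let (q, j) := loc_repr v in frac (p * q) (i + j).

Lemma loc_addE p i q j :
  loc_add (frac p i) (frac q j) = frac (s ^+ j * p + s ^+ i * q) (i + j).
Proof.
rewrite /loc_add; have := loc_reprK (frac p i); have := loc_reprK (frac q j).
case: (loc_repr (frac p i)) (loc_repr (frac q j)) => [p' i'] [q' j'] /=.
move=> /frac_eqP[l eq] /frac_eqP[k ep]; apply/frac_eqP; exists (k + l)%N.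
move: eq ep; rewrite !exprD => eq ep.
transitivity (s ^+ l * s ^+ j * s ^+ j' * (s ^+ k * s ^+ i * p') +
  s ^+ k * s ^+ i * s ^+ i' * (s ^+ l * s ^+ j * q')); first by ring.
by rewrite ep eq; ring.
Qed.

Lemma loc_oppE p i : loc_opp (frac p i) = frac (- p) i.
Proof.
rewrite /loc_opp; have := loc_reprK (frac p i).
case: (loc_repr _) => [p' i'] /= /frac_eqP[k ep].
by apply/frac_eqP; exists k; rewrite !mulrN ep.
Qed.

Lemma loc_mulE p i q j : loc_mul (frac p i) (frac q j) = frac (p * q) (i + j).
Proof.
rewrite /loc_mul; have := loc_reprK (frac p i); have := loc_reprK (frac q j).
case: (loc_repr (frac p i)) (loc_repr (frac q j)) => [p' i'] [q' j'] /=.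
move=> /frac_eqP[l eq] /frac_eqP[k ep]; apply/frac_eqP; exists (k + l)%N.
move: eq ep; rewrite !exprD => eq ep.
transitivity ((s ^+ k * s ^+ i * p') * (s ^+ l * s ^+ j * q')); first by ring.
by rewrite ep eq; ring.
Qed.

Fact loc_addA : associative loc_add.
Proof.
elim/loc_ind=> p i; elim/loc_ind=> q j; elim/loc_ind=> r k.
by rewrite !loc_addE addnA !exprD; congr frac; ring.
Qed.
Fact loc_addC : commutative loc_add.
Proof.
by elim/loc_ind=> p i; elim/loc_ind=> q j; rewrite !loc_addE addnC addrC.
Qed.
Fact loc_add0 : left_id (frac 0 0) loc_add.
Proof.
by elim/loc_ind=> p i; rewrite loc_addE mulr0 add0r expr0 mul1r.
Qed.
Fact loc_addN : left_inverse (frac 0 0) loc_opp loc_add.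
Proof.
elim/loc_ind=> p i; rewrite loc_oppE loc_addE; apply/frac_eqP; exists 0%N.
by rewrite mulrN addNr !mulr0.
Qed.
HB.instance Definition _ :=
  GRing.isZmodule.Build loc loc_addA loc_addC loc_add0 loc_addN.

Fact loc_mulA : associative loc_mul.
Proof.
elim/loc_ind=> p i; elim/loc_ind=> q j; elim/loc_ind=> r k.
by rewrite !loc_mulE mulrA addnA.
Qed.
Fact loc_mulC : commutative loc_mul.
Proof.
by elim/loc_ind=> p i; elim/loc_ind=> q j; rewrite !loc_mulE mulrC addnC.
Qed.
Fact loc_mul1 : left_id (frac 1 0) loc_mul.
Proof. by elim/loc_ind=> p i; rewrite loc_mulE mul1r. Qed.
Fact loc_mulDl : left_distributive loc_mul +%R.
Proof.
elim/loc_ind=> p i; elim/loc_ind=> q j; elim/loc_ind=> r k.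
rewrite /GRing.add /= !(loc_addE, loc_mulE).
by apply/frac_eqP; exists 0%N; rewrite !exprD; ring.
Qed.
HB.instance Definition _ := GRing.Zmodule_isComPzRing.Build loc
  loc_mulA loc_mulC loc_mul1 loc_mulDl.

Definition loc_in (p : A) : loc := frac p 0.
Fact loc_in_zmod : zmod_morphism loc_in.
Proof.
move=> p q; rewrite /loc_in /GRing.add /GRing.opp /= loc_oppE loc_addE.
by rewrite expr0 !mul1r.
Qed.
HB.instance Definition _ := GRing.isZmodMorphism.Build A loc loc_in loc_in_zmod.
Fact loc_in_monoid : monoid_morphism loc_in.
Proof. by split=> // p q; rewrite /loc_in /GRing.mul /= loc_mulE. Qed.
HB.instance Definition _ :=
  GRing.isMonoidMorphism.Build A loc loc_in loc_in_monoid.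

Lemma loc_inV : loc_in s * frac 1 1 = 1.
Proof.
rewrite [LHS]loc_mulE mulr1; apply/frac_eqP; exists 0%N.
by rewrite mulr1 mul1r.
Qed.
End Loc.

(* The additive map on finite formal sums with value h x k on << k *g x >>. *)
Definition mlift (T : choiceType) (G V : zmodType) (h : T -> G -> V)
  (g : {malg G[T]}) : V := \sum_(x <- msupp g) h x g@_x.

Section Mlift.
Variables (T : choiceType) (G V : zmodType) (h : T -> G -> V).
Hypothesis h_zmod : forall x, zmod_morphism (h x).

Let h0 x : h x 0 = 0.
Proof. by rewrite -[in LHS](subrr 0) h_zmod subrr. Qed.

Lemma mlift_wide (D : {fset T}) (g : {malg G[T]}) :
  (msupp g `<=` D)%fset -> mlift h g = \sum_(x <- D) h x g@_x.
Proof.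
move=> sgD; apply: big_fset_incl => // x _ /mcoeff_outdom ->; exact: h0.
Qed.

Lemma mlift_zmod : zmod_morphism (mlift h).
Proof.
move=> g1 g2; pose D := (msupp g1 `|` msupp g2)%fset.
rewrite !(@mlift_wide D) ?fsubsetUl ?fsubsetUr ?msuppB_le //.
by rewrite -sumrB; apply: eq_bigr => x _; rewrite mcoeffB h_zmod.
Qed.

Lemma mliftU k x : mlift h << k *g x >> = h x k.
Proof. by rewrite (mlift_wide msuppU_le) big_seq_fset1 mcoeffUU. Qed.

Lemma mlift0 : mlift h 0 = 0.
Proof. by rewrite -(subrr (0 : {malg G[T]})) mlift_zmod subrr. Qed.

Lemma mliftD : {morph mlift h : g1 g2 / g1 + g2}.
Proof.
have liftN g : mlift h (- g) = - mlift h g.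
  by rewrite -[- g]sub0r mlift_zmod mlift0 sub0r.
by move=> g1 g2; rewrite -[g2 in LHS]opprK mlift_zmod liftN opprK.
Qed.
End Mlift.

Lemma malg_ind (T : choiceType) (G : zmodType) (P : {malg G[T]} -> Prop) :
  P 0 -> (forall g1 g2, P g1 -> P g2 -> P (g1 + g2)) ->
  (forall k x, P << k *g x >>) -> forall g, P g.
Proof. by move=> P0 PD PU g; rewrite [g]monalgE; apply: big_ind. Qed.

Section Tensor.
Variables (R K : comPzRingType) (f : {rmorphism R -> K}) (M : lmodType R).
Local Notation F := {malg int[(M * K)%type]}.

Inductive tens_span : F -> Prop :=
| tens_spanDl m m' k : tens_span (<< (m + m', k) >> - << (m, k) >> - << (m', k) >>)
| tens_spanDr m k k' : tens_span (<< (m, k + k') >> - << (m, k) >> - << (m, k') >>)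
| tens_spanZ r m k : tens_span (<< (r *: m, k) >> - << (m, f r * k) >>)
| tens_span0 : tens_span 0
| tens_spanB g g' of tens_span g & tens_span g' : tens_span (g - g').

Definition tens_pred : {pred F} := [pred g | `[< tens_span g >]].
Fact tens_zmod_closed : zmod_closed tens_pred.
Proof.
split=> [|u v /asboolP Xu /asboolP Xv]; apply/asboolP; first exact: tens_span0.
exact: tens_spanB.
Qed.
HB.instance Definition _ := GRing.isZmodClosed.Build F tens_pred tens_zmod_closed.

(* M (x)_R K, where K is an R-module through f *)
Definition tens : Type := Quotient.quot tens_pred.
HB.instance Definition _ := GRing.Zmodule.on tens.

Definition tens_pi (g : F) : tens := \pi_(Quotient.quot tens_pred) g.
Definition tens_repr (u : tens) : F := repr (u : Quotient.quot tens_pred).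
Lemma tens_reprK : cancel tens_repr tens_pi.
Proof. exact: reprK. Qed.

Lemma tens_eqP g g' : tens_pi g = tens_pi g' <-> tens_span (g - g').
Proof.
split=> [/eqP|Iuv]; first by rewrite /tens_pi -Quotient.idealrBE => /asboolP.
by apply/eqP; rewrite /tens_pi -Quotient.idealrBE; apply/asboolP.
Qed.

Fact tens_pi_zmod : zmod_morphism tens_pi.
Proof. by move=> u v; rewrite /tens_pi !piE. Qed.
HB.instance Definition _ := GRing.isZmodMorphism.Build F tens tens_pi tens_pi_zmod.

End Tensor.
Arguments tens {R K} f M.

(* m (x) k *)
HB.lock Definition pure (R K : comPzRingType) (f : {rmorphism R -> K})
  (M : lmodType R) (m : M) (k : K) : tens f M := tens_pi f << (m, k) >>.

(* phi is R-balanced and additive in each argument. *)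
Definition balanced (R K : comPzRingType) (f : {rmorphism R -> K})
    (M : lmodType R) (V : zmodType) (phi : M -> K -> V) : Prop :=
  [/\ forall k, zmod_morphism (phi^~ k), forall m, zmod_morphism (phi m)
    & forall r m k, phi (r *: m) k = phi m (f r * k)].

(* For balanced phi, the additive map with value phi m k on m (x) k. *)
HB.lock Definition tens_lift (R K : comPzRingType) (f : {rmorphism R -> K})
  (M : lmodType R) (V : zmodType) (phi : M -> K -> V) (u : tens f M) : V :=
  mlift (fun x n => phi x.1 x.2 *~ n) (tens_repr u).

Section TensorTheory.
Variables (R K : comPzRingType) (f : {rmorphism R -> K}) (M : lmodType R).
Local Notation tens := (tens f M).
Local Notation pure := (@pure R K f M).
Local Notation F := {malg int[(M * K)%type]}.

Lemma pureE m k : pure m k = tens_pi f << (m, k) >>.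
Proof. by rewrite unlock. Qed.

Lemma pureDl k : {morph pure^~ k : m m' / m + m'}.
Proof.
by move=> m m'; rewrite !pureE -raddfD; apply/tens_eqP; rewrite opprD addrA;
  apply: tens_spanDl.
Qed.
Lemma pureDr m : {morph pure m : k k' / k + k'}.
Proof.
by move=> k k'; rewrite !pureE -raddfD; apply/tens_eqP; rewrite opprD addrA;
  apply: tens_spanDr.
Qed.
Lemma pureZ r m k : pure (r *: m) k = pure m (f r * k).
Proof. by rewrite !pureE; apply/tens_eqP; apply: tens_spanZ. Qed.

Lemma pure0l k : pure 0 k = 0.
Proof. by apply: (addrI (pure 0 k)); rewrite -pureDl !addr0. Qed.
Lemma pure0r m : pure m 0 = 0.
Proof. by apply: (addrI (pure m 0)); rewrite -pureDr !addr0. Qed.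
Lemma pureNl m k : pure (- m) k = - pure m k.
Proof. by apply/eqP; rewrite -addr_eq0 -pureDl addNr pure0l. Qed.

Lemma tens_ind (P : tens -> Prop) :
  (forall u v, P u -> P v -> P (u + v)) -> (forall m k, P (pure m k)) ->
  forall u, P u.
Proof.
move=> PD Ppure u; rewrite -[u]tens_reprK.
have PMn m k n : P (pure m k *+ n).
  elim: n => [|n IHn]; first by rewrite mulr0n -(pure0l 0).
  by rewrite mulrS; apply: PD.
elim/malg_ind: (tens_repr u) => [|g g' Pg Pg'|n [m k]].
- by rewrite raddf0 -(pure0l 0).
- by rewrite raddfD; apply: PD.
have -> : << n *g (m, k) >> = << (m, k) >> *~ n.
  by rewrite -[n in LHS]intz raddfMz.
rewrite raddfMz /= -pureE; case: n => n; first exact: PMn.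
by rewrite NegzE mulrNz -mulNrz -pureNl; apply: PMn.
Qed.

Section Lift.
Variables (V : zmodType) (phi : M -> K -> V).
Hypothesis phi_bal : balanced f phi.
Local Notation ml := (mlift (fun x n => phi x.1 x.2 *~ n)).

Let ml_zmod : zmod_morphism ml.
Proof. by apply: mlift_zmod => x m n; rewrite mulrzBr. Qed.
Let mlU x : ml << x >> = phi x.1 x.2.
Proof. by rewrite mliftU // => y m n; rewrite mulrzBr. Qed.

Let zmod_add (U : zmodType) (g : U -> V) :
  zmod_morphism g -> {morph g : x y / x + y}.
Proof.
move=> gB x y; have g0 : g 0 = 0 by rewrite -[0 in LHS](subrr 0) gB subrr.
have gN z : g (- z) = - g z by rewrite -[- z]sub0r gB g0 sub0r.
by rewrite -[y in LHS]opprK gB gN opprK.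
Qed.

Let ml_span g : tens_span f g -> ml g = 0.
Proof.
have [phiDl phiDr phiZ] := phi_bal.
elim=> [m m' k|m k k'|r m k||g1 g2 _ IH1 _ IH2]; rewrite ?ml_zmod ?mlU /=.
- by rewrite (zmod_add (phiDl k)) addrAC addrK subrr.
- by rewrite (zmod_add (phiDr m)) addrAC addrK subrr.
- by rewrite phiZ subrr.
- by rewrite -(subrr (0 : F)) ml_zmod subrr.
- by rewrite IH1 IH2 subrr.
Qed.

Lemma tens_lift_pi g : @tens_lift R K f M V phi (tens_pi f g) = ml g.
Proof.
apply/eqP; rewrite unlock -subr_eq0 -ml_zmod.
apply/eqP/ml_span/tens_eqP; exact: tens_reprK.
Qed.

Lemma tens_lift_zmod : zmod_morphism (@tens_lift R K f M V phi).
Proof.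
move=> u v; rewrite -[u]tens_reprK -[v]tens_reprK -raddfB !tens_lift_pi.
exact: ml_zmod.
Qed.
Lemma tens_liftD : {morph @tens_lift R K f M V phi : u v / u + v}.
Proof. exact/zmod_add/tens_lift_zmod. Qed.
Lemma tens_liftE m k : @tens_lift R K f M V phi (pure m k) = phi m k.
Proof. by rewrite pureE tens_lift_pi mlU. Qed.
End Lift.

Definition tens_scale (k : K) : tens -> tens :=
  @tens_lift R K f M tens (fun m l => pure m (k * l)).

Fact tens_scale_bal k : balanced f (fun m l => pure m (k * l)).
Proof.
split=> [l m m'|m l l'|r m l]; last by rewrite pureZ mulrCA.
- by rewrite pureDl pureNl.
- by apply/eqP; rewrite eq_sym subr_eq -pureDr -mulrDr subrK.
Qed.
Lemma tens_scaleE k m l : tens_scale k (pure m l) = pure m (k * l).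
Proof. by rewrite /tens_scale tens_liftE //; apply: tens_scale_bal. Qed.
Fact tens_scaleDr : right_distributive tens_scale +%R.
Proof. by move=> k; apply/tens_liftD/tens_scale_bal. Qed.
Fact tens_scaleA k l u : tens_scale k (tens_scale l u) = tens_scale (k * l) u.
Proof.
elim/tens_ind: u => [u v IHu IHv|m p]; first by rewrite !tens_scaleDr IHu IHv.
by rewrite !tens_scaleE mulrA.
Qed.
Fact tens_scale1 : left_id 1 tens_scale.
Proof.
elim/tens_ind=> [u v IHu IHv|m p]; first by rewrite tens_scaleDr IHu IHv.
by rewrite tens_scaleE mul1r.
Qed.
Fact tens_scaleDl u : {morph tens_scale^~ u : k l / k + l}.
Proof.
move=> k l; elim/tens_ind: u => [u v IHu IHv|m p].
  by rewrite !tens_scaleDr IHu IHv addrACA.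
by rewrite !tens_scaleE mulrDl pureDr.
Qed.
HB.instance Definition _ := GRing.Zmodule_isLmodule.Build K tens
  tens_scaleA tens_scale1 tens_scaleDr tens_scaleDl.
End TensorTheory.
Arguments pure {R K} f {M} m k.

Section TensorAlg.
Variables (R K : comPzRingType) (f : {rmorphism R -> K}) (A : pzAlgType R).

(* A (x)_R K, with the product (u (x) k) (v (x) l) = u v (x) k l *)
Definition tensa : Type := tens f (amod A).
HB.instance Definition _ := GRing.Zmodule.on tensa.
Definition purea (u : A) (k : K) : tensa := pure f (u : amod A) k.

Let pDl k : {morph purea^~ k : m m' / m + m'}.
Proof. exact: (@pureDl _ _ f (amod A) k). Qed.
Let pDr m : {morph purea m : k k' / k + k'}.
Proof. exact: (@pureDr _ _ f (amod A) m). Qed.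
Let pBl k : zmod_morphism (purea^~ k).
Proof. by move=> u v; apply/eqP; rewrite eq_sym subr_eq -pDl subrK. Qed.
Let pBr u : zmod_morphism (purea u).
Proof. by move=> k l; apply/eqP; rewrite eq_sym subr_eq -pDr subrK. Qed.
Let pZ r u k : purea (palg r * u) k = purea u (f r * k).
Proof. exact: (@pureZ _ _ f (amod A) r u k). Qed.

Lemma tensa_ind (P : tensa -> Prop) :
  (forall x y, P x -> P y -> P (x + y)) -> (forall u k, P (purea u k)) ->
  forall x, P x.
Proof. exact: (@tens_ind _ _ f (amod A)). Qed.

Definition tensa_mul1 (u : A) (k : K) : tensa -> tensa :=
  @tens_lift R K f (amod A) tensa (fun v l => purea (u * (v : A)) (k * l)).

Fact tensa_mul1_bal u k :
  balanced f (fun (v : amod A) l => purea (u * (v : A)) (k * l)).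
Proof.
split=> [l v v'|v l l'|r v l].
- by rewrite -pBl -mulrBr.
- by rewrite -pBr -mulrBr.
by rewrite amod_scaleE mulrA -palgC -mulrA pZ mulrCA.
Qed.
Lemma tensa_mul1D u k : {morph tensa_mul1 u k : x y / x + y}.
Proof. exact: (tens_liftD (tensa_mul1_bal u k)). Qed.
Lemma tensa_mul1E u k v l : tensa_mul1 u k (purea v l) = purea (u * v) (k * l).
Proof. exact: (tens_liftE (tensa_mul1_bal u k)). Qed.

Definition tensa_mul (x y : tensa) : tensa :=
  @tens_lift R K f (amod A) tensa (fun u k => tensa_mul1 u k y) x.

Fact tensa_mul_bal (y : tensa) :
  balanced f (fun (u : amod A) k => tensa_mul1 u k y).
Proof.
split=> [k u u'|u k k'|r u k]; elim/tensa_ind: y => [x y IHx IHy|v l].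
- by rewrite !tensa_mul1D IHx IHy opprD addrACA.
- by rewrite !tensa_mul1E -pBl -mulrBl.
- by rewrite !tensa_mul1D IHx IHy opprD addrACA.
- by rewrite !tensa_mul1E -pBr -mulrBl.
- by rewrite !tensa_mul1D IHx IHy.
- by rewrite !tensa_mul1E amod_scaleE -mulrA pZ mulrA.
Qed.

Fact tensa_mulDl : left_distributive tensa_mul +%R.
Proof. by move=> x y z; apply: (tens_liftD (tensa_mul_bal z)). Qed.
Lemma tensa_mulEl u k y : tensa_mul (purea u k) y = tensa_mul1 u k y.
Proof. exact: (tens_liftE (tensa_mul_bal y)). Qed.
Lemma tensa_mulE u k v l :
  tensa_mul (purea u k) (purea v l) = purea (u * v) (k * l).
Proof. by rewrite tensa_mulEl tensa_mul1E. Qed.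
Fact tensa_mulDr : right_distributive tensa_mul +%R.
Proof.
move=> x y z; elim/tensa_ind: x => [x x' IHx IHx'|u k].
  by rewrite !tensa_mulDl IHx IHx' addrACA.
by rewrite !tensa_mulEl tensa_mul1D.
Qed.
Fact tensa_mulA : associative tensa_mul.
Proof.
move=> x y z; elim/tensa_ind: x => [x x' IHx IHx'|u k].
  by rewrite !tensa_mulDl IHx IHx'.
elim/tensa_ind: y => [y y' IHy IHy'|v l].
  by rewrite !(tensa_mulDl, tensa_mulDr) IHy IHy'.
elim/tensa_ind: z => [z z' IHz IHz'|w m]; first by rewrite !tensa_mulDr IHz IHz'.
by rewrite !tensa_mulE !mulrA.
Qed.
Fact tensa_mul1r : left_id (purea 1 1) tensa_mul.
Proof.
elim/tensa_ind=> [x y IHx IHy|u k]; first by rewrite tensa_mulDr IHx IHy.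
by rewrite tensa_mulE !mul1r.
Qed.
Fact tensa_mulr1 : right_id (purea 1 1) tensa_mul.
Proof.
elim/tensa_ind=> [x y IHx IHy|u k]; first by rewrite tensa_mulDl IHx IHy.
by rewrite tensa_mulE !mulr1.
Qed.
HB.instance Definition _ := GRing.Zmodule_isPzRing.Build tensa
  tensa_mulA tensa_mul1r tensa_mulr1 tensa_mulDl tensa_mulDr.

Definition tensa_palg (k : K) : tensa := purea 1 k.
Fact tensa_palg_zmod : zmod_morphism tensa_palg.
Proof. exact: pBr. Qed.
Fact tensa_palg_monoid : monoid_morphism tensa_palg.
Proof. by split=> // k l; rewrite /GRing.mul /= tensa_mulE mulr1. Qed.
Fact tensa_palgC k (x : tensa) : tensa_palg k * x = x * tensa_palg k.
Proof.
elim/tensa_ind: x => [x y IHx IHy|u l]; first by rewrite mulrDr mulrDl IHx IHy.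
by rewrite /GRing.mul /= !tensa_mulE mul1r mulr1 mulrC.
Qed.
HB.instance Definition _ := PzRing_isPzAlgebra.Build K tensa
  tensa_palg_zmod tensa_palg_monoid tensa_palgC.

(* u |-> u (x) 1 *)
Definition tensa_in (u : A) : tensa := purea u 1.
Fact tensa_in_zmod : zmod_morphism tensa_in.
Proof. exact: pBl. Qed.
HB.instance Definition _ :=
  GRing.isZmodMorphism.Build A tensa tensa_in tensa_in_zmod.
Fact tensa_in_monoid : monoid_morphism tensa_in.
Proof. by split=> // u v; rewrite /GRing.mul /= tensa_mulE mulr1. Qed.
HB.instance Definition _ :=
  GRing.isMonoidMorphism.Build A tensa tensa_in tensa_in_monoid.
End TensorAlg.
Arguments tensa {R K} f A.
Arguments purea {R K} f {A} u k.
Arguments tensa_in {R K} f {A} u.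

(* g (x) id, for a morphism g of R-algebras *)
Definition tensa_map (R K : comPzRingType) (f : {rmorphism R -> K})
  (A B : pzAlgType R) (g : A -> B) : tensa f A -> tensa f B :=
  tens_lift (fun (u : amod A) k => purea f (g u) k).

Lemma tensa_map_bal (R K : comPzRingType) (f : {rmorphism R -> K})
    (A B : pzAlgType R) (g : {rmorphism A -> B}) :
  (forall r, g (palg r) = palg r) ->
  balanced f (fun (u : amod A) k => purea f (g u) k).
Proof.
move=> g_palg; split=> [l v v'|v l l'|r v l].
- by apply/eqP; rewrite eq_sym subr_eq -pureDl -!(raddfD g) subrK.
- by apply/eqP; rewrite eq_sym subr_eq -pureDr subrK.
by rewrite amod_scaleE rmorphM g_palg; apply: (@pureZ _ _ f (amod B)).
Qed.

Lemma tensa_mapE (R K : comPzRingType) (f : {rmorphism R -> K})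
    (A B : pzAlgType R) (g : {rmorphism A -> B}) (u : A) (k : K) :
  (forall r, g (palg r) = palg r) ->
  tensa_map g (purea f u k) = purea f (g u) k.
Proof. by move=> g_palg; apply: (tens_liftE (tensa_map_bal f g_palg)). Qed.

(* A word over X: (x, false) is the generator x, (x, true) its inverse. *)
Definition word (X : choiceType) : Type := seq (X * bool).

(* The congruence on words whose classes are the elements of <X | rel>. *)
Inductive word_eq (X : choiceType) (rel : word X -> word X -> Prop) :
  word X -> word X -> Prop :=
| word_rel w w' of rel w w' : word_eq rel w w'
| word_cancel x b : word_eq rel [:: (x, b); (x, ~~ b)] [::]
| word_refl w : word_eq rel w w
| word_sym w w' of word_eq rel w w' : word_eq rel w' w
| word_trans w w' w'' of word_eq rel w w' & word_eq rel w' w'' :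
    word_eq rel w w''
| word_cat w w' v v' of word_eq rel w w' & word_eq rel v v' :
    word_eq rel (w ++ v) (w' ++ v').

Section PresentedGroup.
Variables (X : choiceType) (rel : word X -> word X -> Prop).

Definition word_eqb (w w' : word X) := `[< word_eq rel w w' >].
Fact word_eqb_class : equiv_class_of word_eqb.
Proof.
split=> [w|w w'|w w' w''].
- by apply/asboolP/word_refl.
- by apply/asboolP/asboolP; apply: word_sym.
- by move=> /asboolP e /asboolP e'; apply/asboolP/(word_trans e e').
Qed.
Canonical word_equiv := EquivRelPack word_eqb_class.

(* The group <X | rel> *)
Definition pgroup : Type := {eq_quot word_eqb}.
HB.instance Definition _ := Choice.on pgroup.
Definition pg_pi (w : word X) : pgroup := \pi_({eq_quot word_eqb}) w.
Definition pg_repr (g : pgroup) : word X := repr (g : {eq_quot word_eqb}).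
Definition pg_gen (x : X) : pgroup := pg_pi [:: (x, false)].

Lemma pg_reprK : cancel pg_repr pg_pi.
Proof. exact: reprK. Qed.
Lemma pg_eqP w w' : pg_pi w = pg_pi w' <-> word_eq rel w w'.
Proof. by split=> [/eqmodP/asboolP|e]; last exact/eqmodP/asboolP. Qed.
Lemma pg_ind (P : pgroup -> Prop) : (forall w, P (pg_pi w)) -> forall g, P g.
Proof. by move=> Ppi g; rewrite -[g]pg_reprK. Qed.

Definition word_inv (w : word X) : word X := [seq (p.1, ~~ p.2) | p <- rev w].

Lemma word_invP w : word_eq rel (word_inv w ++ w) [::].
Proof.
elim: w => [|[x b] w IHw]; first exact: word_refl.
rewrite /word_inv rev_cons map_rcons cat_rcons -/(word_inv w) /=.
apply: word_trans IHw; apply: word_cat; first exact: word_refl.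
rewrite -[_ :: _ :: w]/([:: (x, ~~ b); (x, b)] ++ w) -[in X in word_eq _ _ X](cat0s w).
by apply: word_cat (word_refl _ _); rewrite -{2}[b]negbK; apply: word_cancel.
Qed.
Lemma word_invK : involutive word_inv.
Proof.
move=> w; rewrite /word_inv -map_rev revK -map_comp -[RHS]map_id.
by apply: eq_map => -[x b] /=; rewrite negbK.
Qed.
Lemma word_inv_eq w w' : word_eq rel w w' -> word_eq rel (word_inv w) (word_inv w').
Proof.
move=> e; apply: word_trans (_ : word_eq rel (word_inv w ++ w' ++ word_inv w') _).
  rewrite -[in X in word_eq _ X _](cats0 (word_inv w)).
  apply: word_cat (word_refl _ _) (word_sym _).
  by rewrite -{1}[w']word_invK; apply: word_invP.
rewrite catA -[in X in word_eq _ _ X](cat0s (word_inv w')).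
apply: word_cat (word_refl _ _); apply: word_trans (word_invP w).
exact/word_cat/word_sym/e/word_refl.
Qed.

Definition pg_mul (g h : pgroup) : pgroup := pg_pi (pg_repr g ++ pg_repr h).
Definition pg_inv (g : pgroup) : pgroup := pg_pi (word_inv (pg_repr g)).

Lemma pg_mulE w w' : pg_mul (pg_pi w) (pg_pi w') = pg_pi (w ++ w').
Proof. by apply/pg_eqP/word_cat; apply/pg_eqP/pg_reprK. Qed.
Lemma pg_invE w : pg_inv (pg_pi w) = pg_pi (word_inv w).
Proof. by apply/pg_eqP/word_inv_eq/pg_eqP/pg_reprK. Qed.

Fact pg_mulA : associative pg_mul.
Proof.
elim/pg_ind=> u; elim/pg_ind=> v; elim/pg_ind=> w.
by rewrite !pg_mulE catA.
Qed.
Fact pg_mul1 : left_id (pg_pi [::]) pg_mul.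
Proof. by elim/pg_ind=> w; rewrite pg_mulE. Qed.
Fact pg_mulr1 : right_id (pg_pi [::]) pg_mul.
Proof. by elim/pg_ind=> w; rewrite pg_mulE cats0. Qed.
Fact pg_mulV : left_inverse (pg_pi [::]) pg_inv pg_mul.
Proof. by elim/pg_ind=> w; rewrite pg_invE pg_mulE; apply/pg_eqP/word_invP. Qed.
Fact pg_mulrV : right_inverse (pg_pi [::]) pg_inv pg_mul.
Proof.
elim/pg_ind=> w; rewrite pg_invE pg_mulE; apply/pg_eqP.
by rewrite -{1}[w]word_invK; apply: word_invP.
Qed.
HB.instance Definition _ := isGroup.Build pgroup
  pg_mulA pg_mul1 pg_mulr1 pg_mulV pg_mulrV.
End PresentedGroup.
Arguments pg_gen {X} rel x.
Arguments pg_pi {X} rel w.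

(* The homomorphism <X | rel> -> <Y | rel'> given on generators by f, when f maps
   rel into the congruence of rel'. *)
Definition pg_map (X Y : choiceType) (rel : word X -> word X -> Prop)
    (rel' : word Y -> word Y -> Prop) (f : X -> Y) (g : pgroup rel) :
  pgroup rel' := pg_pi rel' [seq (f p.1, p.2) | p <- pg_repr g].

Lemma pg_mapE (X Y : choiceType) (rel : word X -> word X -> Prop)
    (rel' : word Y -> word Y -> Prop) (f : X -> Y) (w : word X) :
  (forall u v, rel u v ->
    word_eq rel' [seq (f p.1, p.2) | p <- u] [seq (f p.1, p.2) | p <- v]) ->
  pg_map rel' f (pg_pi rel w) = pg_pi rel' [seq (f p.1, p.2) | p <- w].
Proof.
move=> f_rel; apply/pg_eqP.
have: word_eq rel (pg_repr (pg_pi rel w)) w by apply/pg_eqP/pg_reprK.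
move: (pg_repr _) => w'; elim=> [u v /f_rel //|x b|u|u v _ IH|u v t _ IH _ IH'|u u' v v' _ IH _ IH'].
- exact: (word_cancel rel' (f x) b).
- exact: word_refl.
- exact: word_sym.
- exact: word_trans IH IH'.
- by rewrite !map_cat; apply: word_cat.
Qed.

(* The group algebra K[G] *)
Definition galg (K : comNzRingType) (G : groupType) : Type := {malg K[G]}.
HB.instance Definition _ K G := GRing.Zmodule.on (galg K G).

(* k x *)
HB.lock Definition gmon (K : comNzRingType) (G : groupType) (k : K) (x : G) :
  galg K G := << k *g x >>.

Section GroupAlgebra.
Variables (K : comNzRingType) (G : groupType).
Local Notation galg := (galg K G).
Local Notation gmon := (@gmon K G).

Lemma gmonE k x : gmon k x = << k *g x >>.
Proof. by rewrite unlock. Qed.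

Lemma galg_ind (P : galg -> Prop) :
  (forall u v, P u -> P v -> P (u + v)) -> (forall k x, P (gmon k x)) ->
  forall u, P u.
Proof.
move=> PD PU u; elim/malg_ind: u => [||k x] //; last by rewrite -gmonE.
by rewrite -(monalgU0 1%g) -gmonE.
Qed.

Lemma gmonBl x : zmod_morphism (gmon^~ x).
Proof. by move=> k l; rewrite !gmonE raddfB. Qed.

Definition galg_mul1 (x : G) (k : K) : galg -> galg :=
  mlift (fun y l => gmon (k * l) (x * y)%g).
Fact galg_mul1_zmod x k : zmod_morphism (galg_mul1 x k).
Proof. by apply: mlift_zmod => y l l'; rewrite mulrBr gmonBl. Qed.
Fact galg_mul1E x k y l : galg_mul1 x k (gmon l y) = gmon (k * l) (x * y)%g.
Proof.
by rewrite /galg_mul1 [gmon l y]gmonE mliftU // => {l}y l l'; rewrite mulrBr gmonBl.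
Qed.
Fact galg_mul1D x k : {morph galg_mul1 x k : u v / u + v}.
Proof. by apply: mliftD => y l l'; rewrite mulrBr gmonBl. Qed.

Definition galg_mul (u v : galg) : galg :=
  mlift (fun x k => galg_mul1 x k v) u.
Fact galg_mul1_bil (v : galg) x : zmod_morphism (fun k => galg_mul1 x k v).
Proof.
move=> k l; elim/galg_ind: v => [u v IHu IHv|m y].
  by rewrite !galg_mul1D IHu IHv opprD addrACA.
by rewrite !galg_mul1E mulrBl gmonBl.
Qed.
Fact galg_mulDl : left_distributive galg_mul +%R.
Proof. by move=> u v w; apply/mliftD/galg_mul1_bil. Qed.
Fact galg_mulEl k x v : galg_mul (gmon k x) v = galg_mul1 x k v.
Proof. by rewrite gmonE; apply: (mliftU (galg_mul1_bil v)). Qed.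
Lemma galg_mulE k x l y :
  galg_mul (gmon k x) (gmon l y) = gmon (k * l) (x * y)%g.
Proof. by rewrite galg_mulEl galg_mul1E. Qed.

Fact galg_mulDr : right_distributive galg_mul +%R.
Proof.
move=> u v w; elim/galg_ind: u => [u u' IHu IHu'|k x].
  by rewrite !galg_mulDl IHu IHu' addrACA.
by rewrite !galg_mulEl galg_mul1D.
Qed.
Fact galg_mulA : associative galg_mul.
Proof.
move=> u v w; elim/galg_ind: u => [u u' IHu IHu'|k x].
  by rewrite !galg_mulDl IHu IHu'.
elim/galg_ind: v => [v v' IHv IHv'|l y].
  by rewrite galg_mulDl !galg_mulDr galg_mulDl IHv IHv'.
elim/galg_ind: w => [w w' IHw IHw'|m z].
  by rewrite !galg_mulDr IHw IHw'.
by rewrite !galg_mulE mulrA mulgA.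
Qed.
Fact galg_mul1r : left_id (gmon 1 1%g) galg_mul.
Proof.
elim/galg_ind=> [u v IHu IHv|k x]; first by rewrite galg_mulDr IHu IHv.
by rewrite galg_mulE mul1r mul1g.
Qed.
Fact galg_mulr1 : right_id (gmon 1 1%g) galg_mul.
Proof.
elim/galg_ind=> [u v IHu IHv|k x]; first by rewrite galg_mulDl IHu IHv.
by rewrite galg_mulE mulr1 mulg1.
Qed.
HB.instance Definition _ := GRing.Zmodule_isPzRing.Build galg
  galg_mulA galg_mul1r galg_mulr1 galg_mulDl galg_mulDr.

Definition galg_palg (k : K) : galg := gmon k 1%g.
Fact galg_palg_zmod : zmod_morphism galg_palg.
Proof. exact: gmonBl. Qed.
Fact galg_palg_monoid : monoid_morphism galg_palg.
Proof. by split=> // k l; rewrite /GRing.mul /= galg_mulE mulg1. Qed.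
Fact galg_palgC k (u : galg) : galg_palg k * u = u * galg_palg k.
Proof.
elim/galg_ind: u => [u v IHu IHv|l x]; first by rewrite mulrDr mulrDl IHu IHv.
by rewrite /GRing.mul /= !galg_mulE mulg1 mul1g mulrC.
Qed.
HB.instance Definition _ := PzRing_isPzAlgebra.Build K galg
  galg_palg_zmod galg_palg_monoid galg_palgC.
End GroupAlgebra.
Arguments gmon {K G} k x.

Definition gelt (K : comNzRingType) (G : groupType) (x : G) : galg K G :=
  gmon 1 x.

Definition galg_map (K : comNzRingType) (G H : groupType) (f : G -> H) :
  galg K G -> galg K H := mlift (fun x k => gmon k (f x)).

Lemma galg_mapE (K : comNzRingType) (G H : groupType) (f : G -> H) k x :
  galg_map f (gmon k x : galg K G) = gmon k (f x).
Proof. by rewrite [gmon k x]gmonE; apply: mliftU => y l l'; rewrite gmonBl. Qed.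

Section QuotMapMorphism.
Variables (A B : pzRingType) (X : A -> Prop) (Y : B -> Prop).
Variable f : {rmorphism A -> B}.
Hypothesis fX : forall u, X u -> ideal Y (f u).

Lemma quot_map_zmod : zmod_morphism (quot_map Y f : quot X -> quot Y).
Proof.
elim/quot_ind=> u; elim/quot_ind=> v.
by rewrite -rmorphB !quot_mapE // !rmorphB.
Qed.
Lemma quot_map_monoid : monoid_morphism (quot_map Y f : quot X -> quot Y).
Proof.
split; first by rewrite -(rmorph1 (quot_pi X)) quot_mapE // !rmorph1.
elim/quot_ind=> u; elim/quot_ind=> v.
by rewrite -rmorphM !quot_mapE // !rmorphM.
Qed.
End QuotMapMorphism.

Section TensorMapMorphism.
Variables (R K : comPzRingType) (f : {rmorphism R -> K}) (A B : pzAlgType R).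
Variable g : {rmorphism A -> B}.
Hypothesis g_palg : forall r, g (palg r) = palg r.

Lemma tensa_map_zmod : zmod_morphism (tensa_map g : tensa f A -> tensa f B).
Proof. exact: (tens_lift_zmod (tensa_map_bal f g_palg)). Qed.
Lemma tensa_mapD : {morph (tensa_map g : tensa f A -> tensa f B) : x y / x + y}.
Proof. exact: (tens_liftD (tensa_map_bal f g_palg)). Qed.
Lemma tensa_map_monoid : monoid_morphism (tensa_map g : tensa f A -> tensa f B).
Proof.
split; first by rewrite [1]/(purea f 1 1) tensa_mapE // rmorph1.
move=> x y; elim/tensa_ind: x => [x x' IHx IHx'|u k].
  by rewrite mulrDl !tensa_mapD mulrDl IHx IHx'.
elim/tensa_ind: y => [y y' IHy IHy'|v l].
  by rewrite mulrDr !tensa_mapD mulrDr IHy IHy'.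
rewrite /GRing.mul /= tensa_mulE !tensa_mapE // rmorphM.
by rewrite tensa_mulE.
Qed.
End TensorMapMorphism.

Section GalgMapMorphism.
Variables (K : comNzRingType) (G H : groupType) (f : G -> H).
Hypothesis fM : {morph f : x y / (x * y)%g}.

Lemma galg_map_zmod : zmod_morphism (galg_map f : galg K G -> galg K H).
Proof. by apply: mlift_zmod => x k l; rewrite gmonBl. Qed.
Lemma galg_mapD : {morph (galg_map f : galg K G -> galg K H) : u v / u + v}.
Proof. by apply: mliftD => x k l; rewrite gmonBl. Qed.
Lemma galg_map_monoid : monoid_morphism (galg_map f : galg K G -> galg K H).
Proof.
have f1 : f 1%g = 1%g by apply: (@mulgI _ (f 1%g)); rewrite -fM !mulg1.
split; first by rewrite (_ : 1 = gmon 1 1%g) // galg_mapE f1.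
move=> x y; elim/galg_ind: x => [x x' IHx IHx'|k u].
  by rewrite mulrDl !galg_mapD mulrDl IHx IHx'.
elim/galg_ind: y => [y y' IHy IHy'|l v].
  by rewrite mulrDr !galg_mapD mulrDr IHy IHy'.
by rewrite /GRing.mul /= galg_mulE !galg_mapE fM galg_mulE.
Qed.
End GalgMapMorphism.

From mathcomp Require Import mpoly.

(* Below, n is the number of Artin generators: the objects of index n are those
   on n + 1 strands, so that n : nat ranges over all strand numbers >= 1. The
   *_incl, from n + 1 to n + 2 strands, send artin i to artin i. *)
Inductive braid_rel (n : nat) : word 'I_n -> word 'I_n -> Prop :=
| braid_far (i j : 'I_n) of (i.+1 < j)%N :
    braid_rel [:: (i, false); (j, false)] [:: (j, false); (i, false)]
| braid_near (i j : 'I_n) of j = i.+1 :> nat :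
    braid_rel [:: (i, false); (j, false); (i, false)]
              [:: (j, false); (i, false); (j, false)].

Definition braid (n : nat) : groupType := pgroup (@braid_rel n).
Definition artin (n : nat) (i : 'I_n) : braid n := pg_gen (@braid_rel n) i.
Definition braid_incl (n : nat) : braid n -> braid n.+1 :=
  pg_map (@braid_rel n.+1) (widen_ord (leqnSn n)).

Lemma braid_incl_rel n (u v : word 'I_n) : braid_rel u v ->
  word_eq (@braid_rel n.+1) [seq (widen_ord (leqnSn n) p.1, p.2) | p <- u]
                            [seq (widen_ord (leqnSn n) p.1, p.2) | p <- v].
Proof.
by case=> [i j ij|i j ij]; apply: word_rel; [apply: braid_far|apply: braid_near].
Qed.
Lemma braid_incl_artin n (i : 'I_n) :
  braid_incl (artin i) = artin (widen_ord (leqnSn n) i).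
Proof. exact: pg_mapE (@braid_incl_rel n). Qed.
Lemma braid_inclM n : {morph @braid_incl n : g h / (g * h)%g}.
Proof.
elim/pg_ind=> u; elim/pg_ind=> v; rewrite /braid_incl.
rewrite [(_ * _)%g]pg_mulE !(pg_mapE _ (@braid_incl_rel n)) map_cat.
by rewrite [RHS]pg_mulE.
Qed.

HB.lock Definition abc : mpoly.mpoly 3 rat := 'X_0 * 'X_1 * 'X_2.

(* Q[a, b, c, 1 / (a b c)] *)
Definition ringR : Type := loc abc.
HB.instance Definition _ := GRing.ComPzRing.on ringR.
Fact ringR_neq0 : 1 != 0 :> ringR.
Proof.
apply/eqP => /frac_eqP[k] /(congr1 (meval (fun=> 1))) /eqP.
rewrite mulr0 mulr1 meval0 rmorphXn /= abc.unlock !mevalM !mevalXU.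
by rewrite !mul1r expr1n oner_eq0.
Qed.
HB.instance Definition _ := GRing.PzSemiRing_isNonZero.Build ringR ringR_neq0.

HB.lock Definition Ra : ringR := loc_in abc 'X_0.
HB.lock Definition Rb : ringR := loc_in abc 'X_1.
HB.lock Definition Rc : ringR := loc_in abc 'X_2.
Definition Rx : ringR := Rb + Rc.
Definition Ry : ringR := Rb * Rc.

(* S = R[1 / x] *)
Definition ringS : comPzRingType := loc Rx.
Definition RtoS : {rmorphism ringR -> ringS} := loc_in Rx.
Definition xinv : ringS := frac Rx 1 1.

(* S / (a - y) for sg = false, S / (a + y) for sg = true: sg stands for the sign
   (-1) ^+ sg. *)
Definition Spm_rel (sg : bool) (u : ringS) : Prop :=
  u = RtoS Ra - (-1) ^+ sg * RtoS Ry.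
Definition ringSpm (sg : bool) : comPzRingType := quot (Spm_rel sg).
Definition StoSpm sg : {rmorphism ringS -> ringSpm sg} := quot_pi (Spm_rel sg).
Definition RtoSpm sg : {rmorphism ringR -> ringSpm sg} := StoSpm sg \o RtoS.

(* S / (a^2 - y^2) *)
Definition Sbar_rel (u : ringS) : Prop := u = RtoS (Ra ^+ 2 - Ry ^+ 2).
Definition ringSbar : comPzRingType := quot Sbar_rel.
Definition StoSbar : {rmorphism ringS -> ringSbar} := quot_pi Sbar_rel.
Definition RtoSbar : {rmorphism ringR -> ringSbar} := StoSbar \o RtoS.

(* The components ringSbar -> ringSpm sg of the Chinese remainder isomorphism *)
Definition SbartoSpm (sg : bool) : ringSbar -> ringSpm sg :=
  quot_map (Spm_rel sg) id.

Lemma SbartoSpmE sg u : SbartoSpm sg (StoSbar u) = StoSpm sg u.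
Proof.
apply: (quot_mapE (f := idfun)) => v ->.
have -> : RtoS (Ra ^+ 2 - Ry ^+ 2) =
    (RtoS Ra + (-1) ^+ sg * RtoS Ry) * (RtoS Ra - (-1) ^+ sg * RtoS Ry).
  by rewrite rmorphB !rmorphXn; case: sg; rewrite ?expr0 ?expr1; ring.
exact/idealMl/ideal_gen.
Qed.

(* Sbar[1 / (a^2 - y)] *)
Definition ringL : comPzRingType := loc (RtoSbar (Ra ^+ 2 - Ry)).
Definition SbartoL : {rmorphism ringSbar -> ringL} :=
  loc_in (RtoSbar (Ra ^+ 2 - Ry)).
Definition RtoL : {rmorphism ringR -> ringL} := SbartoL \o RtoSbar.

Definition braid_alg (n : nat) : pzAlgType ringR := galg ringR (braid n).
Definition braid_alg_incl (n : nat) : braid_alg n -> braid_alg n.+1 :=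
  galg_map (@braid_incl n).

Definition cubic_rel (n : nat) (u : braid_alg n) : Prop :=
  exists i : 'I_n, let s : braid_alg n := gelt _ (artin i) in
  u = (s - palg Ra) * (s - palg Rb) * (s - palg Rc).

Definition cubicH (n : nat) : pzAlgType ringR := quot (@cubic_rel n).
Definition H_pi (n : nat) : braid_alg n -> cubicH n := quot_pi (@cubic_rel n).
Definition H_br (n : nat) (g : braid n) : cubicH n := H_pi (gelt _ g).
Definition H_incl (n : nat) : cubicH n -> cubicH n.+1 :=
  quot_map (@cubic_rel n.+1) (@braid_alg_incl n).

Definition bmw_rel (n : nat) (u : cubicH n) : Prop :=
  exists i j : 'I_n, j = i.+1 :> nat /\
  let s := H_br (artin i) in let s' := H_br (artin j) in
  let r := H_br (artin i)^-1%g in let r' := H_br (artin j)^-1%g in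
  let x := palg Rx in let y := palg Ry in
  u = - y * (s * r' * s) + y ^+ 2 * (r' * s * r') - s * s' * s
      - x * y ^+ 2 * (r' * r') + x * (s * s) + y ^+ 3 * (r' * r * r').

Definition BMWt (n : nat) : pzAlgType ringR := quot (@bmw_rel n).
Definition BMWt_pi (n : nat) : cubicH n -> BMWt n := quot_pi (@bmw_rel n).
Definition BMWt_incl (n : nat) : BMWt n -> BMWt n.+1 :=
  quot_map (@bmw_rel n.+1) (@H_incl n).

Definition hecke_rel (n : nat) (u : braid_alg n) : Prop :=
  exists i : 'I_n, let s : braid_alg n := gelt _ (artin i) in
  u = (s - palg Rb) * (s - palg Rc).

Definition heckeH (n : nat) : pzAlgType ringR := quot (@hecke_rel n).
Definition hecke_pi (n : nat) : braid_alg n -> heckeH n := quot_pi (@hecke_rel n).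
Definition hecke_incl (n : nat) : heckeH n -> heckeH n.+1 :=
  quot_map (@hecke_rel n.+1) (@braid_alg_incl n).

Definition Hpm (sg : bool) (n : nat) : pzAlgType (ringSpm sg) :=
  tensa (RtoSpm sg) (cubicH n).
Definition Hpm_br (sg : bool) (n : nat) (g : braid n) : Hpm sg n :=
  tensa_in (RtoSpm sg) (H_br g).

Definition Hpm_incl (sg : bool) (n : nat) : Hpm sg n -> Hpm sg n.+1 :=
  tensa_map (@H_incl n).

(* e_i = (a s_i^-1 + eps s_i) / x - eps, with eps = (-1) ^+ sg *)
Definition Hpm_e (sg : bool) (n : nat) (i : 'I_n) : Hpm sg n :=
  palg (StoSpm sg xinv) *
    (palg (RtoSpm sg Ra) * Hpm_br sg (artin i)^-1%g
     + (-1) ^+ sg * Hpm_br sg (artin i)) - (-1) ^+ sg.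

Definition bmwpm_rel (sg : bool) (n : nat) (u : Hpm sg n) : Prop :=
  exists i j : 'I_n, [/\ i = 0%N :> nat, j = 1%N :> nat &
    let e := Hpm_e sg i in
    u = e * Hpm_br sg (artin j) * e - e \/
    u = e * Hpm_br sg (artin j)^-1%g * e - e].

Definition BMWpm (sg : bool) (n : nat) : pzAlgType (ringSpm sg) :=
  quot (@bmwpm_rel sg n).
Definition BMWpm_pi (sg : bool) (n : nat) : Hpm sg n -> BMWpm sg n :=
  quot_pi (@bmwpm_rel sg n).
Definition BMWpm_incl (sg : bool) (n : nat) : BMWpm sg n -> BMWpm sg n.+1 :=
  quot_map (@bmwpm_rel sg n.+1) (@Hpm_incl sg n).

Module Export InclMorphisms.
HB.instance Definition _ n := GRing.isZmodMorphism.Build _ _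
  (@braid_alg_incl n) (@galg_map_zmod _ _ _ (@braid_incl n)).
HB.instance Definition _ n := GRing.isMonoidMorphism.Build _ _
  (@braid_alg_incl n) (galg_map_monoid _ (@braid_inclM n)).

Lemma braid_incl1 n : @braid_incl n 1%g = 1%g.
Proof. by apply: (@mulgI _ (braid_incl 1%g)); rewrite -braid_inclM !mulg1. Qed.
Lemma braid_alg_incl_gelt n (g : braid n) :
  braid_alg_incl (gelt _ g) = gelt _ (braid_incl g).
Proof. exact: galg_mapE. Qed.
Lemma braid_alg_incl_palg n k : @braid_alg_incl n (palg k) = palg k.
Proof. by rewrite [LHS]galg_mapE braid_incl1. Qed.

Fact cubic_rel_incl n (u : braid_alg n) :
  cubic_rel u -> ideal (@cubic_rel n.+1) (braid_alg_incl u).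
Proof.
case=> i ->; apply: ideal_gen; exists (widen_ord (leqnSn n) i).
by rewrite !rmorphM !rmorphB /= !braid_alg_incl_palg braid_alg_incl_gelt
  braid_incl_artin.
Qed.
HB.instance Definition _ n := GRing.isZmodMorphism.Build _ _
  (@H_incl n) (quot_map_zmod (@cubic_rel_incl n)).
HB.instance Definition _ n := GRing.isMonoidMorphism.Build _ _
  (@H_incl n) (quot_map_monoid (@cubic_rel_incl n)).

Lemma H_incl_br n (g : braid n) : H_incl (H_br g) = H_br (braid_incl g).
Proof.
by rewrite [LHS](quot_mapE _ (@cubic_rel_incl n)) /= braid_alg_incl_gelt.
Qed.
Lemma H_incl_palg n k : @H_incl n (palg k) = palg k.
Proof.
by rewrite [LHS](quot_mapE _ (@cubic_rel_incl n)) /= braid_alg_incl_palg.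
Qed.

Lemma braid_incl_artinV n (i : 'I_n) :
  braid_incl (artin i)^-1%g = (artin (widen_ord (leqnSn n) i))^-1%g.
Proof.
apply: (@mulgI _ (braid_incl (artin i))).
by rewrite -braid_inclM mulgV braid_incl1 braid_incl_artin mulgV.
Qed.

Fact bmw_rel_incl n (u : cubicH n) :
  bmw_rel u -> ideal (@bmw_rel n.+1) (H_incl u).
Proof.
case=> i [j [ij ->]]; apply: ideal_gen.
exists (widen_ord (leqnSn n) i), (widen_ord (leqnSn n) j); split=> //=.
by rewrite !(rmorphD, rmorphB, rmorphN, rmorphM, rmorphXn) /= !H_incl_palg
  !H_incl_br !braid_incl_artinV !braid_incl_artin.
Qed.
HB.instance Definition _ n := GRing.isZmodMorphism.Build _ _
  (@BMWt_incl n) (quot_map_zmod (@bmw_rel_incl n)).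
HB.instance Definition _ n := GRing.isMonoidMorphism.Build _ _
  (@BMWt_incl n) (quot_map_monoid (@bmw_rel_incl n)).
Lemma BMWt_incl_pi n (u : cubicH n) : BMWt_incl (BMWt_pi u) = BMWt_pi (H_incl u).
Proof. exact: quot_mapE (@bmw_rel_incl n). Qed.

Fact hecke_rel_incl n (u : braid_alg n) :
  hecke_rel u -> ideal (@hecke_rel n.+1) (braid_alg_incl u).
Proof.
case=> i ->; apply: ideal_gen; exists (widen_ord (leqnSn n) i).
by rewrite !rmorphM !rmorphB /= !braid_alg_incl_palg braid_alg_incl_gelt
  braid_incl_artin.
Qed.
HB.instance Definition _ n := GRing.isZmodMorphism.Build _ _
  (@hecke_incl n) (quot_map_zmod (@hecke_rel_incl n)).
HB.instance Definition _ n := GRing.isMonoidMorphism.Build _ _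
  (@hecke_incl n) (quot_map_monoid (@hecke_rel_incl n)).
Lemma hecke_incl_pi n (u : braid_alg n) :
  hecke_incl (hecke_pi u) = hecke_pi (braid_alg_incl u).
Proof. exact: quot_mapE (@hecke_rel_incl n). Qed.

HB.instance Definition _ sg n := GRing.isZmodMorphism.Build _ _
  (@Hpm_incl sg n) (@tensa_map_zmod _ _ (RtoSpm sg) _ _ _ (@H_incl_palg n)).
HB.instance Definition _ sg n := GRing.isMonoidMorphism.Build _ _
  (@Hpm_incl sg n) (@tensa_map_monoid _ _ (RtoSpm sg) _ _ _ (@H_incl_palg n)).

Lemma Hpm_incl_br sg n (g : braid n) :
  Hpm_incl (Hpm_br sg g) = Hpm_br sg (braid_incl g).
Proof.
by rewrite /Hpm_incl [LHS](tensa_mapE _ _ _ (@H_incl_palg n)) /= H_incl_br.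
Qed.
Lemma Hpm_incl_palg sg n k : @Hpm_incl sg n (palg k) = palg k.
Proof.
by rewrite /Hpm_incl [LHS](tensa_mapE _ _ _ (@H_incl_palg n)) /= rmorph1.
Qed.

Fact bmwpm_rel_incl sg n (u : Hpm sg n) :
  bmwpm_rel u -> ideal (@bmwpm_rel sg n.+1) (Hpm_incl u).
Proof.
case=> i [j [i0 j1 /= uE]]; apply: ideal_gen.
have incl_e : Hpm_incl (Hpm_e sg i) = Hpm_e sg (widen_ord (leqnSn n) i).
  by rewrite /Hpm_e !(rmorphB, rmorphD, rmorphM, rmorphXn, rmorphN, rmorph1)
    /= !Hpm_incl_palg !Hpm_incl_br !braid_incl_artinV !braid_incl_artin.
exists (widen_ord (leqnSn n) i), (widen_ord (leqnSn n) j); split=> //=.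
by case: uE => ->; [left|right]; rewrite rmorphB !rmorphM /= incl_e Hpm_incl_br
  ?braid_incl_artinV ?braid_incl_artin.
Qed.
HB.instance Definition _ sg n := GRing.isZmodMorphism.Build _ _
  (@BMWpm_incl sg n) (quot_map_zmod (@bmwpm_rel_incl sg n)).
HB.instance Definition _ sg n := GRing.isMonoidMorphism.Build _ _
  (@BMWpm_incl sg n) (quot_map_monoid (@bmwpm_rel_incl sg n)).
Lemma BMWpm_incl_pi sg n (u : Hpm sg n) :
  BMWpm_incl (BMWpm_pi u) = BMWpm_pi (Hpm_incl u).
Proof. exact: quot_mapE (@bmwpm_rel_incl sg n). Qed.

End InclMorphisms.

(* A tower of quotients of the group algebras of the braid groups: the algebra on
   n + 1 strands, the images in it of the braids, and the maps iota. *)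
Record tower (K : comPzRingType) := Tower {
  tower_alg :> nat -> pzAlgType K;
  tower_br : forall n, braid n -> tower_alg n;
  tower_incl : forall n, tower_alg n -> tower_alg n.+1
}.
Arguments tower_br {K} t {n}.
Arguments tower_incl {K} t {n}.

Definition BMWt_tower : tower ringR :=
  Tower (fun n g => BMWt_pi (H_br g)) BMWt_incl.
Definition hecke_tower : tower ringR :=
  Tower (fun n g => hecke_pi (gelt _ g)) hecke_incl.
Definition BMWpm_tower (sg : bool) : tower (ringSpm sg) :=
  Tower (fun n g => BMWpm_pi (Hpm_br sg g)) (@BMWpm_incl sg).

Definition markov_trace (K : comPzRingType) (A : tower K) (V : lmodType K)
    (t : forall n, A n -> V) : Prop :=
  [/\ forall n, linear (t n : amod (A n) -> V),
      forall n (u v : A n), t n (u * v) = t n (v * u),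
      forall n (u : A n),
        t n.+1 (tower_incl A u * tower_br A (artin ord_max)) = t n u
    & forall n (u : A n),
        t n.+1 (tower_incl A u * tower_br A (artin ord_max)^-1%g) = t n u].

Definition ocneanu_trace (t : forall n, BMWt n -> ringS) : Prop :=
  [/\ markov_trace (A := BMWt_tower) (V := restr RtoS ringS^o) t,
      t 0%N 1 = 1
    & exists2 th : forall n, heckeH n -> ringS,
        markov_trace (A := hecke_tower) (V := restr RtoS ringS^o) th
      & forall n (u : braid_alg n), t n (BMWt_pi (H_pi u)) = th n (hecke_pi u)].

Definition kauffman_trace_pm (sg : bool)
    (t : forall n, BMWpm sg n -> ringSpm sg) : Prop :=
  [/\ markov_trace (A := BMWpm_tower sg) (V := (ringSpm sg)^o) t,
      t 0%N 1 = 1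
    & t 1%N 1 = (RtoSpm sg Ry - (-1) ^+ sg * RtoSpm sg Rx + 1)
                * StoSpm sg xinv].

(* t is glued from the two traces by the Chinese remainder isomorphism. *)
Definition kauffman_trace (t : forall n, BMWt n -> ringSbar) : Prop :=
  markov_trace (A := BMWt_tower) (V := restr RtoSbar ringSbar^o) t /\
  exists2 tpm : forall sg n, BMWpm sg n -> ringSpm sg,
    forall sg, kauffman_trace_pm (tpm sg)
  & forall sg n (u : cubicH n),
      SbartoSpm sg (t n (BMWt_pi u))
        = tpm sg n (BMWpm_pi (tensa_in (RtoSpm sg) u)).

(* Main.v *)
From HB Require Import structures.
Require Import Defs.
From mathcomp Require Import all_boot all_algebra.
From mathcomp Require Import ssrAC ring mpoly.

Set Implicit Arguments.
Unset Strict Implicit.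
Unset Printing Implicit Defensive.
Import GRing.Theory.
Local Open Scope ring_scope.

(* A Markov trace T with T_1(1) = T_2(1) = 0 vanishes as soon as
   x^2 y (y - a^2) acts injectively on its values. Write A_n for the algebra on n
   strands. The relation R_i and its mirror image, together with the cubic
   relation, give A_(n+1) = A_n + A_n s_n A_n + A_n s_n^-1 A_n, so that T_(n+1)
   vanishes if T_n = 0 and T_(n+1) vanishes on A_n. Conjugation by s_1 ... s_n
   turns s_(n-1) into s_n and A_(n-1) into a subalgebra of A_n, hence
   T_(n+1)(B s_(n-1)^(+-1)) = 0 for B in A_(n-1). Finally
   T_(n+1)(B R_(n-1)) = 0 reduces to x^2 y (y - a^2) T_(n+1)(B) = 0.
   The theorem follows by subtracting from T the combination of the two known
   traces with the same values at 1 on one and two strands; it exists because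
   their values on two strands are (1 + y) / x and (1 + y) / x - a / y, where
   (a / y)^2 = 1. *)

(** * Identities in algebras with cubic generators *)

Section Cubic.
Variables (K : comPzRingType) (A : pzAlgType K).
Implicit Types (k : K) (u v s r : A).

Lemma mulr_palg k u v : u * (palg k * v) = palg k * (u * v).
Proof. by rewrite mulrA -palgC mulrA. Qed.

Lemma quadratic_expand k l s :
  (s - palg k) * (s - palg l) = s * s - palg (k + l) * s + palg (k * l).
Proof.
rewrite mulrBl !mulrBr -(palgC l s) rmorphD rmorphM mulrDl opprB opprD !addrA.
by rewrite [LHS](ACl (1*4*2*3)).
Qed.

(** Multiplying the quadratic relation by the inverse [r] gives the skein form used for the Hecke
    algebra. *)
Lemma quadratic_skein k l s r : s * r = 1 ->
  (s - palg k) * (s - palg l) = 0 -> palg (k + l) = s + palg (k * l) * r.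
Proof.
move=> sr1 /(congr1 ( *%R^~ r)); rewrite mul0r quadratic_expand mulrDl mulrBl.
by rewrite -!mulrA sr1 !mulr1 addrAC => /eqP; rewrite subr_eq0 => /eqP.
Qed.

(** Multiply the cubic relation by [r]. The coefficients are grouped around [l + m] and [l * m] so
    that, for the roots a, b, c, they read directly in terms of x = b + c and y = bc. *)
Lemma cubic_square k l m s r : s * r = 1 ->
  (s - palg k) * (s - palg l) * (s - palg m) = 0 ->
  s * s = palg (k + (l + m)) * s - palg (k * (l + m) + l * m)
          + palg (k * (l * m)) * r.
Proof.
move=> sr1 /(congr1 ( *%R^~ r)); rewrite mul0r quadratic_expand -mulrA mulrBl sr1.
rewrite mulrBr mulr1 [_ * (palg m * r)]mulr_palg mulrDl mulrBl.
rewrite -[s * s * r]mulrA -[_ * s * r]mulrA sr1 !mulr1 => /eqP.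
rewrite subr_eq0 -addrA => /eqP/(canRL (addrK _)).
rewrite mulrDr mulrBr [palg m * (_ * r)]mulrA -!rmorphM opprD opprK !addrA => ->.
rewrite [LHS](ACl ((1*4)*(2*5)*3)) /= -mulrDl -opprD -!rmorphD.
by congr (palg _ * _ - palg _ + palg _ * _); ring.
Qed.
End Cubic.

(** * Conjugation, written without inverting the conjugating element *)

Section Intertwine.
Variables (K : comPzRingType) (A : pzAlgType K) (d : A).

Definition intertwines (u v : A) := d * u = v * d.

Lemma intertwinesD u v u' v' :
  intertwines u v -> intertwines u' v' -> intertwines (u + u') (v + v').
Proof. by rewrite /intertwines mulrDr mulrDl => -> ->. Qed.
Lemma intertwinesN u v : intertwines u v -> intertwines (- u) (- v).
Proof. by rewrite /intertwines mulrN mulNr => ->. Qed.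
Lemma intertwinesM u v u' v' :
  intertwines u v -> intertwines u' v' -> intertwines (u * u') (v * v').
Proof. by rewrite /intertwines mulrA => ->; rewrite -mulrA => ->; rewrite mulrA. Qed.
Lemma intertwines_palg k : intertwines (palg k) (palg k).
Proof. by rewrite /intertwines palgC. Qed.
Lemma intertwinesV u v u' v' :
  u * u' = 1 -> v' * v = 1 -> intertwines u v -> intertwines u' v'.
Proof.
move=> uu' vv' duv; rewrite /intertwines -[d * u']mul1r -vv' -mulrA [v * _]mulrA.
by rewrite -duv -[d * u * u']mulrA uu' mulr1.
Qed.
End Intertwine.

(* The element generating the relation R_i, for s = s_i, s' = s_(i+1), of inverses
   r and r' *)
Definition bmw_elt (K : comPzRingType) (A : pzAlgType K) (x y : K)
    (s r s' r' : A) : A :=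
  - palg y * (s * r' * s) + palg y ^+ 2 * (r' * s * r') - s * s' * s
  - palg x * palg y ^+ 2 * (r' * r') + palg x * (s * s)
  + palg y ^+ 3 * (r' * r * r').

Lemma rmorph_bmw_elt (K : comPzRingType) (A B : pzAlgType K) (f : {rmorphism A -> B})
    (x y : K) (s r s' r' : A) : (forall k, f (palg k) = palg k) ->
  f (bmw_elt x y s r s' r') = bmw_elt x y (f s) (f r) (f s') (f r').
Proof.
by move=> f_palg;
  rewrite /bmw_elt !(rmorphD, rmorphB, rmorphN, rmorphM, rmorphXn) /= !f_palg.
Qed.

(** * Words on three strands *)

Section Strand3.
Variables (K : comPzRingType) (A : pzAlgType K) (x y : K) (s r s' r' : A).
Hypotheses (sr : s * r = 1) (rs : r * s = 1) (s'r' : s' * r' = 1)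
  (r's' : r' * s' = 1) (near : s * s' * s = s' * s * s').

(** This and the next four lemmas are the braid relation with letters cancelled against their
    inverses. Together with [near] they rewrite six of the eight words s'^(+-1) s^(+-1) s'^(+-1)
    with a single letter s'^(+-1); the words r' s r' and s' r s' remain. *)
Lemma near_mixed : s' * s * r' = r * s' * s.
Proof.
rewrite -[LHS]mul1r -rs -!mulrA; congr (r * _).
by rewrite !mulrA near -!mulrA s'r' mulr1.
Qed.
Lemma near_mixedV : r' * s * s' = s * s' * r.
Proof.
rewrite -[LHS]mulr1 -sr !mulrA -[r' * s * s' * s]mulrA; congr (_ * r).
by rewrite -!mulrA [s * (s' * s)]mulrA near !mulrA r's' mul1r.
Qed.
Lemma near_mixed2 : s' * r * r' = r * r' * s.
Proof.
rewrite -[RHS]mulr1 -s'r' !mulrA; congr (_ * r').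
rewrite -[LHS]mul1r -rs -!mulrA; congr (r * _).
rewrite -[LHS]mul1r -r's' -!mulrA; congr (r' * _).
by rewrite !mulrA -near -!mulrA sr mulr1.
Qed.
Lemma near_mixed2V : r' * r * s' = s * r' * r.
Proof.
rewrite -[RHS]mul1r -r's' -!mulrA; congr (r' * _).
rewrite -[LHS]mulr1 -sr !mulrA; congr (_ * r).
rewrite -[LHS]mulr1 -s'r' !mulrA; congr (_ * r').
by rewrite -!mulrA [s' * (s * _)]mulrA -near !mulrA rs mul1r.
Qed.
Lemma nearV : r * r' * r = r' * r * r'.
Proof.
rewrite -[RHS]mul1r -rs -!mulrA; congr (r * _).
rewrite -[LHS]mulr1 -s'r' !mulrA; congr (_ * r').
by rewrite near_mixed2V.
Qed.

Lemma half_twist_intertwines : intertwines (s * s' * s) s s'.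
Proof. by rewrite /intertwines {1}near -!mulrA. Qed.
Lemma half_twist_intertwines' : intertwines (s * s' * s) s' s.
Proof. by rewrite /intertwines {2}near !mulrA. Qed.

(* Conjugation by the half twist s s' s exchanges s and s'. *)
Lemma bmw_elt_mirror : bmw_elt x y s r s' r' = 0 -> bmw_elt x y s' r' s r = 0.
Proof.
have i1 := half_twist_intertwines; have i2 := half_twist_intertwines'.
have i3 := intertwinesV sr r's' i1; have i4 := intertwinesV s'r' rs i2.
have : intertwines (s * s' * s) (bmw_elt x y s r s' r') (bmw_elt x y s' r' s r).
  do ![apply: intertwinesD | apply: intertwinesN | apply: intertwinesM];
  by [|apply: intertwines_palg].
rewrite /intertwines => + R0; rewrite R0 mulr0 => /esym/(congr1 ( *%R^~ (r * r' * r))).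
rewrite mul0r -!mulrA [s * (r * _)]mulrA sr mul1r [s' * (r' * _)]mulrA s'r' mul1r sr.
by rewrite mulr1.
Qed.

Section Span.
Variables (yi : K) (S : A -> Prop).
Hypotheses (yyi : yi * y = 1) (S1 : S 1) (Ss' : S s') (Sr' : S r')
  (SD : forall u v, S u -> S v -> S (u + v))
  (SZ : forall k u, S u -> S (palg k * u))
  (Ssl : forall u, S u -> S (s * u)) (Srl : forall u, S u -> S (r * u))
  (Ssr : forall u, S u -> S (u * s)) (Srr : forall u, S u -> S (u * r))
  (R0 : bmw_elt x y s r s' r' = 0)
  (Ss'2 : S (s' * s')) (Sr'2 : S (r' * r')).

Let SN u : S u -> S (- u).
Proof. by move/(SZ (- 1)); rewrite rmorphN rmorph1 mulN1r. Qed.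

(** [S] abstracts the span [stacked] defined below. In the relation R every term other than y^2 r' s
    r' lies in [S], once r' r r' is rewritten as r r' r; since y is invertible, the relation can be
    solved for r' s r'. *)
Lemma span_rsr : S (r' * s * r').
Proof.
have -> : r' * s * r' = palg yi * (palg yi * (palg y ^+ 2 * (r' * s * r'))).
  by rewrite expr2 !mulrA -!rmorphM -[yi * yi * y]mulrA yyi mulr1 yyi rmorph1 mul1r.
do 2!apply: SZ; move/eqP: R0; rewrite /bmw_elt.
rewrite -!addrA addrCA addr_eq0 => /eqP ->; apply: SN.
rewrite mulNr -[palg x * _ * _]mulrA -!rmorphXn.
rewrite -nearV.
by do ![apply: SD | apply: SN | apply: SZ]; auto; rewrite -?mulrA; auto;
  rewrite -[s * s]mulr1 -?mulrA; auto.
Qed.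

(** The same argument for the mirror relation, which is solved for s' r s'; its term s' s s' becomes
    s s' s. *)
Lemma span_srs : S (s' * r * s').
Proof.
have -> : s' * r * s' = palg yi * (palg y * (s' * r * s')).
  by rewrite mulrA -rmorphM yyi rmorph1 mul1r.
apply: SZ; have /eqP := bmw_elt_mirror R0; rewrite /bmw_elt.
rewrite -!addrA mulNr addrC subr_eq0 => /eqP <-.
rewrite -[palg x * _ * _]mulrA -!rmorphXn -near.
by do ![apply: SD | apply: SN | apply: SZ]; auto; rewrite -?mulrA; auto;
  rewrite -[r * r]mulr1 -?mulrA; auto.
Qed.
End Span.
End Strand3.

(** * The trace of the relation R *)

Section TraceStep.
Variables (K : comPzRingType) (A : pzAlgType K) (V : lmodType K) (f : A -> V).
Variables (a x y : K) (s r s' r' B : A).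
Hypotheses (fD : forall u v, f (u + v) = f u + f v)
  (fZ : forall k u, f (palg k * u) = k *: f u)
  (fC : forall u v, f (u * v) = f (v * u)).
Hypotheses (near : r * r' * r = r' * r * r') (R0 : bmw_elt x y s r s' r' = 0)
  (s2 : s * s = palg (a + x) * s - palg (a * x + y) + palg (a * y) * r)
  (r'2 : palg (a * y) * (r' * r') = s' - palg (a + x) + palg (a * x + y) * r')
  (Br' : r' * B = B * r') (fs : f (B * s) = 0) (fr : f (B * r) = 0)
  (fs' : f (B * s') = 0) (fr' : f (B * r') = 0)
  (fss's : f (B * (s * s' * s)) = 0) (fsr's : f (B * (s * r' * s)) = 0)
  (frr'r : f (B * (r * r' * r)) = 0)
  (fs's : f (B * (s' * s)) = 0) (fr's : f (B * (r' * s)) = 0).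

Let fN u : f (- u) = - f u.
Proof. by have := fZ (- 1) u; rewrite rmorphN rmorph1 mulN1r scaleN1r. Qed.
Let fBZ k u : f (B * (palg k * u)) = k *: f (B * u).
Proof. by rewrite mulr_palg fZ. Qed.
Let fBk k : f (B * palg k) = k *: f B.
Proof. by rewrite -palgC fZ. Qed.

(** In a y times the trace of B R, the words s r' s, s s' s and r r' r vanish by hypothesis, and r'
    s r' reduces by cyclicity to words of trace zero. The two squares contribute x y^2 (a + x) and -
    a x y (a x + y); the terms a x y^2 cancel, leaving x^2 y (y - a^2). *)
Lemma trace_bmw_elt : (x ^+ 2 * y * (y - a ^+ 2)) *: f B = 0.
Proof.
(* The factor [a * y] lets [r'2] expand the square of [r'] without a division. *)
have f_r'sr' : (a * y) *: f (B * (r' * s * r')) = 0.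
  have -> : f (B * (r' * s * r')) = f (B * (r' * r' * s)).
    by rewrite mulrA fC mulrA Br' -!mulrA.
  rewrite -fBZ [palg _ * (_ * s)]mulrA r'2 mulrDl mulrBl.
  rewrite 2!mulrDr mulrN !fD fN -[palg _ * r' * s]mulrA !fBZ.
  by rewrite fs's fs fr's !scaler0 subr0 addr0.
have f_r'r' : (a * y) *: f (B * (r' * r')) = - ((a + x) *: f B).
  by rewrite -fBZ r'2 2!mulrDr mulrN !fD fN fBZ fBk fs' fr' scaler0 addr0 add0r.
have f_ss : f (B * (s * s)) = - ((a * x + y) *: f B).
  by rewrite s2 2!mulrDr mulrN !fD fN !fBZ fBk fs fr !scaler0 addr0 add0r.
have := congr1 (fun u => (a * y) *: f (B * u)) R0.
have -> : bmw_elt x y s r s' r' = palg (- y) * (s * r' * s)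
    + palg (y ^+ 2) * (r' * s * r') - s * s' * s
    - palg (x * y ^+ 2) * (r' * r') + palg x * (s * s) + palg (y ^+ 3) * (r * r' * r).
  by rewrite /bmw_elt near (rmorphN palg) (rmorphM palg x) !(rmorphXn palg).
have f0 : f 0 = 0 by have := fZ 0 0; rewrite mulr0 scale0r.
rewrite /= mulr0 f0 5!mulrDr !mulrN !fD !fN !fBZ.
rewrite fsr's fss's frr'r f_ss !scalerDr !scalerN.
have swap k l (v : V) : k *: (l *: v) = l *: (k *: v) by rewrite !scalerA mulrC.
rewrite (swap _ (y ^+ 2)) f_r'sr' (swap _ (x * y ^+ 2)) f_r'r' !scaler0 scalerN.
rewrite addr0 subr0 addr0 add0r opprK !scalerA -scalerBl => <-.
by congr (_ *: _); ring.
Qed.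
End TraceStep.

(** * Relations in the quotient algebras *)

(* Locked: unification is very slow when it unfolds the tower of quotients. *)
HB.lock Definition bmw_br (n : nat) (g : braid n) : BMWt n := BMWt_pi (H_br g).

Section Generators.
Variable n : nat.

Lemma H_piM (u v : braid_alg n) : H_pi (u * v) = H_pi u * H_pi v.
Proof. exact: (rmorphM (quot_pi (@cubic_rel n))). Qed.
Lemma BMWt_piM (u v : cubicH n) : BMWt_pi (u * v) = BMWt_pi u * BMWt_pi v.
Proof. exact: (rmorphM (quot_pi (@bmw_rel n))). Qed.
Lemma H_pi1 : H_pi (1 : braid_alg n) = 1.
Proof. exact: (rmorph1 (quot_pi (@cubic_rel n))). Qed.
Lemma BMWt_pi1 : BMWt_pi (1 : cubicH n) = 1.
Proof. exact: (rmorph1 (quot_pi (@bmw_rel n))). Qed.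
Lemma H_piD (u v : braid_alg n) : H_pi (u + v) = H_pi u + H_pi v.
Proof. exact: (rmorphD (quot_pi (@cubic_rel n))). Qed.
Lemma BMWt_piD (u v : cubicH n) : BMWt_pi (u + v) = BMWt_pi u + BMWt_pi v.
Proof. exact: (rmorphD (quot_pi (@bmw_rel n))). Qed.
Lemma H_piN (u : braid_alg n) : H_pi (- u) = - H_pi u.
Proof. exact: (rmorphN (quot_pi (@cubic_rel n))). Qed.
Lemma BMWt_piN (u : cubicH n) : BMWt_pi (- u) = - BMWt_pi u.
Proof. exact: (rmorphN (quot_pi (@bmw_rel n))). Qed.

Lemma gmonM k l (g h : braid n) :
  gmon k g * gmon l h = gmon (k * l) (g * h)%g :> braid_alg n.
Proof. exact: galg_mulE. Qed.
Lemma gelt1 : gelt ringR (1%g : braid n) = 1.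
Proof. by []. Qed.

Lemma bmw_brE (g : braid n) : bmw_br g = BMWt_pi (H_br g).
Proof. by rewrite bmw_br.unlock. Qed.

Lemma bmw_brM (g h : braid n) : bmw_br (g * h)%g = bmw_br g * bmw_br h.
Proof.
by rewrite !bmw_brE /H_br -BMWt_piM -H_piM /gelt gmonM mulr1.
Qed.
Lemma bmw_br1 : bmw_br (1%g : braid n) = 1.
Proof. by rewrite bmw_brE /H_br gelt1 H_pi1 BMWt_pi1. Qed.
Lemma bmw_brV (g : braid n) : bmw_br g * bmw_br g^-1%g = 1.
Proof. by rewrite -bmw_brM mulgV bmw_br1. Qed.
Lemma bmw_brVl (g : braid n) : bmw_br g^-1%g * bmw_br g = 1.
Proof. by rewrite -bmw_brM mulVg bmw_br1. Qed.

Definition sig (b : bool) (i : 'I_n) : BMWt n :=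
  bmw_br (if b then (artin i)^-1 else artin i)%g.

Lemma sigK b i : sig b i * sig (~~ b) i = 1.
Proof. by case: b; rewrite /sig /= ?bmw_brV ?bmw_brVl. Qed.

Lemma gmon_cons k b i w :
  gmon k (pg_pi (@braid_rel n) ((i, b) :: w)) =
  gelt ringR (if b then (artin i)^-1 else artin i : braid n)%g
    * gmon k (pg_pi (@braid_rel n) w) :> braid_alg n.
Proof.
rewrite /gelt gmonM mul1r; congr gmon.
case: b; last by rewrite [RHS]pg_mulE.
by rewrite [(artin i)^-1%g]pg_invE [RHS]pg_mulE.
Qed.

(** An element lifts to the group algebra, where it is a sum of scalar multiples of words; each word
    is built by prepending letters. This replaces later inductions on braids. *)
Lemma BMWt_ind (P : BMWt n -> Prop) :
  (forall k, P (palg k)) -> (forall u v, P u -> P v -> P (u + v)) ->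
  (forall b i u, P u -> P (sig b i * u)) -> forall u, P u.
Proof.
move=> Pk PD Ps.
suff PH u : P (BMWt_pi (H_pi u)) by elim/quot_ind; elim/quot_ind.
elim/galg_ind: u => [u v Pu Pv|k g]; first by rewrite H_piD BMWt_piD; apply: PD.
elim/pg_ind: g; elim=> [|[i b] w IHw]; first exact: (Pk k).
rewrite gmon_cons H_piM BMWt_piM; have := Ps b i _ IHw.
by rewrite /sig bmw_brE.
Qed.
End Generators.

Lemma RabcE : Ra * Rb * Rc = loc_in abc abc.
Proof.
rewrite Ra.unlock Rb.unlock Rc.unlock.
rewrite -2!(rmorphM (loc_in abc)); congr (loc_in abc _).
by rewrite [RHS]abc.unlock.
Qed.

Lemma Rabc_unit : exists k : ringR, k * (Ra * Rb * Rc) = 1.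
Proof.
exists (Defs.frac abc 1 1); rewrite mulrC RabcE; exact: (loc_inV abc).
Qed.

Section Relations.
Variable n : nat.
Implicit Types (i j : 'I_n) (b : bool).

Lemma BMWt_incl_sig b i : BMWt_incl (sig b i) = sig b (widen_ord (leqnSn n) i).
Proof.
rewrite /sig !bmw_brE BMWt_incl_pi H_incl_br; congr (BMWt_pi (H_br _)).
by case: b; rewrite ?braid_incl_artinV ?braid_incl_artin.
Qed.
Lemma BMWt_incl_palg k : @BMWt_incl n (palg k) = palg k.
Proof.
have -> : palg k = BMWt_pi (palg k) :> BMWt n by [].
by rewrite BMWt_incl_pi H_incl_palg.
Qed.
Lemma BMWt_inclM (u v : BMWt n) : BMWt_incl (u * v) = BMWt_incl u * BMWt_incl v.
Proof. exact: (rmorphM (@BMWt_incl n)). Qed.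
Lemma BMWt_inclD (u v : BMWt n) : BMWt_incl (u + v) = BMWt_incl u + BMWt_incl v.
Proof. exact: (rmorphD (@BMWt_incl n)). Qed.
Lemma BMWt_inclN (u : BMWt n) : BMWt_incl (- u) = - BMWt_incl u.
Proof. exact: (rmorphN (@BMWt_incl n)). Qed.
Lemma BMWt_incl1 : BMWt_incl (1 : BMWt n) = 1.
Proof. exact: (rmorph1 (@BMWt_incl n)). Qed.

Lemma pgroup_rel (w w' : word 'I_n) :
  braid_rel w w' -> pg_pi (@braid_rel n) w = pg_pi (@braid_rel n) w'.
Proof. by move=> ww'; apply/pg_eqP/word_rel. Qed.

Lemma braid_piM (w w' : word 'I_n) :
  (pg_pi (@braid_rel n) w * pg_pi (@braid_rel n) w')%g = pg_pi (@braid_rel n) (w ++ w').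
Proof. exact: pg_mulE. Qed.

Lemma artin_far i j : (i.+1 < j)%N -> (artin i * artin j = artin j * artin i)%g.
Proof.
by move=> ij; rewrite /artin /pg_gen !braid_piM; apply: (pgroup_rel (braid_far ij)).
Qed.
Lemma artin_near i j : j = i.+1 :> nat ->
  (artin i * artin j * artin i = artin j * artin i * artin j)%g.
Proof.
move=> ij; rewrite /artin /pg_gen !(braid_piM [:: _] [:: _]) !braid_piM.
exact: (pgroup_rel (braid_near ij)).
Qed.

Lemma sig_far b c i j : (i.+1 < j)%N -> sig b i * sig c j = sig c j * sig b i.
Proof.
move=> ij; rewrite /sig -!bmw_brM; congr bmw_br.
have E : commute (artin i) (artin j) by apply: artin_far.
change (commute (if b then (artin i)^-1 else artin i)%g
  (if c then (artin j)^-1 else artin j)%g).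
have E1 : commute (if b then (artin i)^-1 else artin i)%g (artin j).
  by case: b => //; apply/commute_sym/commuteV/commute_sym.
by case: c => //; apply/commuteV.
Qed.
Lemma sig_near i j : j = i.+1 :> nat ->
  sig false i * sig false j * sig false i = sig false j * sig false i * sig false j.
Proof. by move=> ij; rewrite /sig -!bmw_brM artin_near. Qed.

Lemma sig_cubic i :
  (sig false i - palg Ra) * (sig false i - palg Rb) * (sig false i - palg Rc) = 0.
Proof.
pose s : braid_alg n := gelt ringR (artin i).
have E : BMWt_pi (H_pi ((s - palg Ra) * (s - palg Rb) * (s - palg Rc))) = 0.
  have -> : H_pi ((s - palg Ra) * (s - palg Rb) * (s - palg Rc)) = H_pi 0.
    apply/quot_eqP; rewrite subr0; apply: ideal_gen; by exists i.
  by rewrite /H_pi /BMWt_pi !raddf0.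
rewrite !(H_piM, H_piD, H_piN, BMWt_piM, BMWt_piD, BMWt_piN) in E.
by rewrite /sig !bmw_brE.
Qed.

Lemma sig_square i : sig false i * sig false i =
  palg (Ra + Rx) * sig false i - palg (Ra * Rx + Ry) + palg (Ra * Ry) * sig true i.
Proof. exact: cubic_square (sigK false i) (sig_cubic i). Qed.

(** Multiply [sig_square] by the inverse generator and isolate the square. The coefficient a y stays
    on the left, as [trace_bmw_elt] expects. *)
Lemma sig_squareV i : palg (Ra * Ry) * (sig true i * sig true i) =
  sig false i - palg (Ra + Rx) + palg (Ra * Rx + Ry) * sig true i.
Proof.
have E := congr1 ( *%R^~ (sig true i)) (sig_square i).
move: E; rewrite -mulrA sigK mulr1 mulrDl mulrBl -!mulrA sigK mulr1 => ->.
by rewrite [RHS](ACl ((1*4)*(2*5)*3)) /= subrr addNr !add0r.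
Qed.

Lemma sig_bmw i j : j = i.+1 :> nat ->
  bmw_elt Rx Ry (sig false i) (sig true i) (sig false j) (sig true j) = 0.
Proof.
move=> ij.
pose h := bmw_elt Rx Ry (H_br (artin i)) (H_br (artin i)^-1%g) (H_br (artin j))
  (H_br (artin j)^-1%g) : cubicH n.
have E : BMWt_pi h = 0.
  have -> : BMWt_pi h = BMWt_pi 0.
    by apply/quot_eqP; rewrite subr0; apply: ideal_gen; exists i, j.
  by rewrite /BMWt_pi raddf0.
have f_palg k : quot_pi (@bmw_rel n) (palg k) = palg k by [].
rewrite -[RHS]E /sig !bmw_brE; symmetry.
by apply: (rmorph_bmw_elt (f := quot_pi (@bmw_rel n))).
Qed.
End Relations.

(** * Spanning *)

Opaque BMWt BMWt_incl.

Definition last_sig n b : BMWt n.+1 := sig b ord_max.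

Lemma last_sigK n b : last_sig n b * last_sig n (~~ b) = 1.
Proof. exact: sigK. Qed.

Lemma last_square n : last_sig n false * last_sig n false =
  palg (Ra + Rx) * last_sig n false - palg (Ra * Rx + Ry)
  + palg (Ra * Ry) * last_sig n true.
Proof. exact: sig_square. Qed.
Lemma last_squareV n : palg (Ra * Ry) * (last_sig n true * last_sig n true) =
  last_sig n false - palg (Ra + Rx) + palg (Ra * Rx + Ry) * last_sig n true.
Proof. exact: sig_squareV. Qed.

(** The image of [BMWt n] involves only generators at distance at least two from the last one. *)
Lemma last_sig_commute n b (u : BMWt n) :
  last_sig n.+1 b * BMWt_incl (BMWt_incl u) = BMWt_incl (BMWt_incl u) * last_sig n.+1 b.
Proof.
elim/BMWt_ind: u => [k|u v IHu IHv|c i u IHu].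
- by rewrite !BMWt_incl_palg palgC.
- by rewrite !BMWt_inclD mulrDr mulrDl IHu IHv.
rewrite !BMWt_inclM !BMWt_incl_sig mulrA -[sig c _ * _ * _]mulrA -IHu !mulrA.
by rewrite /last_sig -sig_far //= ltnS.
Qed.

Section LastPair.
Variable n : nat.
Let i := widen_ord (leqnSn n.+1) (@ord_max n).

Lemma incl_last_sig b : BMWt_incl (last_sig n b) = sig b i.
Proof. exact: BMWt_incl_sig. Qed.

Lemma last_near :
  let s := BMWt_incl (last_sig n false) in let s' := last_sig n.+1 false in
  s * s' * s = s' * s * s'.
Proof. by rewrite /= !incl_last_sig; apply: sig_near. Qed.

Lemma last_bmw :
  bmw_elt Rx Ry (BMWt_incl (last_sig n false)) (BMWt_incl (last_sig n true))
    (last_sig n.+1 false) (last_sig n.+1 true) = 0.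
Proof. by rewrite !incl_last_sig; apply: sig_bmw. Qed.

Lemma incl_last_sigK b :
  BMWt_incl (last_sig n b) * BMWt_incl (last_sig n (~~ b)) = 1.
Proof. by rewrite !incl_last_sig sigK. Qed.
End LastPair.

Lemma Ry_unit : exists k : ringR, k * Ry = 1.
Proof. by have [k kE] := Rabc_unit; exists (k * Ra); rewrite -kE /Ry !mulrA. Qed.
Lemma RaRy_unit : exists k : ringR, k * (Ra * Ry) = 1.
Proof. by have [k kE] := Rabc_unit; exists k; rewrite -kE /Ry !mulrA. Qed.

(** The sum A + A s A + A s^-1 A, with A the image of [BMWt n] and s the last generator. Scalars
    need no constructor of their own, being absorbed by the factors from A. *)
Inductive stacked (n : nat) : BMWt n.+1 -> Prop :=
| stacked_incl u : stacked (BMWt_incl u)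
| stacked_last u b v : stacked (BMWt_incl u * last_sig n b * BMWt_incl v)
| stackedD u v of stacked u & stacked v : stacked (u + v).

Section Stacked.
Variable n : nat.
Implicit Types (u v : BMWt n.+1) (w : BMWt n) (b : bool).

Lemma stacked_mull w u : stacked u -> stacked (BMWt_incl w * u).
Proof.
elim=> [v|v b v'|v v' _ IHv _ IHv'].
- by rewrite -BMWt_inclM; apply: stacked_incl.
- by rewrite !mulrA -BMWt_inclM; apply: stacked_last.
by rewrite mulrDr; apply: stackedD.
Qed.
Lemma stacked_mulr w u : stacked u -> stacked (u * BMWt_incl w).
Proof.
elim=> [v|v b v'|v v' _ IHv _ IHv'].
- by rewrite -BMWt_inclM; apply: stacked_incl.
- by rewrite -mulrA -BMWt_inclM; apply: stacked_last.
by rewrite mulrDl; apply: stackedD.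
Qed.
Lemma stackedZ k u : stacked u -> stacked (palg k * u).
Proof. by rewrite -BMWt_incl_palg; apply: stacked_mull. Qed.
Lemma stackedN u : stacked u -> stacked (- u).
Proof. by move/(stackedZ (- 1)); rewrite rmorphN rmorph1 mulN1r. Qed.
Lemma stacked_palg k : stacked (palg k : BMWt n.+1).
Proof. by rewrite -BMWt_incl_palg; apply: stacked_incl. Qed.
Lemma stacked1 : stacked (1 : BMWt n.+1).
Proof. by rewrite -(BMWt_incl1 n); apply: stacked_incl. Qed.
Lemma stacked_last1 b : stacked (last_sig n b).
Proof. by have := @stacked_last n 1 b 1; rewrite BMWt_incl1 mulr1 mul1r. Qed.

(** Opposite signs cancel; equal signs fall under the cubic relation, with a y inverted for the
    square of the inverse. *)
Lemma stacked_last2 b c : stacked (last_sig n b * last_sig n c).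
Proof.
have [->|] := eqVneq c (~~ b); first by rewrite last_sigK; apply: stacked1.
case: b; case: c => // _.
  have [k kE] := RaRy_unit.
  have -> : last_sig n true * last_sig n true =
    palg k * (palg (Ra * Ry) * (last_sig n true * last_sig n true)).
    by rewrite mulrA -(rmorphM palg) kE rmorph1 mul1r.
  apply: stackedZ; rewrite last_squareV.
  by do ![apply: stackedD | apply: stackedN | apply: stacked_palg
    | apply: stacked_last1 | apply: stackedZ].
rewrite last_square.
by do ![apply: stackedD | apply: stackedN | apply: stacked_palg
    | apply: stacked_last1 | apply: stackedZ].
Qed.
End Stacked.

(** Six sign patterns follow from the braid relation alone. The patterns r' s r' and s' r s' require
    the relation R and its mirror image. *)
Lemma stacked_last3 n b c d :
  stacked (last_sig n.+1 b * BMWt_incl (last_sig n c) * last_sig n.+1 d).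
Proof.
have [y yE] := Ry_unit.
have sr := incl_last_sigK n false; have rs := incl_last_sigK n true.
have sr' := last_sigK n.+1 false; have rs' := last_sigK n.+1 true.
rewrite /= in sr rs sr' rs'.
have near := last_near n; rewrite /= in near.
have bmw := last_bmw n.
have S1 := stacked1 n.+1; have SL b := stacked_last1 n.+1 b.
have Sl w := @stacked_mull n.+1 w; have Sr w := @stacked_mulr n.+1 w.
case: b; case: c; case: d.
- by rewrite -(nearV sr rs sr' rs' near); auto.
- by rewrite (near_mixed2V sr rs sr' rs' near); auto.
- exact: (span_rsr (S := @stacked n.+1) sr rs sr' rs' near yE S1 (SL _) (SL _)
    (@stackedD _) (@stackedZ _) (Sl _) (Sl _) (Sr _) (Sr _) bmw (stacked_last2 _ _ _)).
- by rewrite (near_mixedV sr rs' near); auto.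
- by rewrite (near_mixed2 sr rs sr' rs' near); auto.
- exact: (span_srs (S := @stacked n.+1) sr rs sr' rs' near yE S1 (SL _) (SL _)
    (@stackedD _) (@stackedZ _) (Sl _) (Sl _) (Sr _) (Sr _) bmw (stacked_last2 _ _ _)).
- by rewrite (near_mixed rs sr' near); auto.
- by rewrite -near; auto.
Qed.

Lemma BMWt0_scalar (u : BMWt 0) : exists k, u = palg k.
Proof.
elim/BMWt_ind: u => [k|u v [k ->] [l ->]|b [] //]; first by exists k.
by exists (k + l); rewrite rmorphD.
Qed.

(** It suffices that the span is stable under left multiplication by each generator. Only the last
    one, applied to a term [w] s^(+-1) [v], is not immediate. *)
Lemma stackedP n (u : BMWt n.+1) : stacked u.
Proof.
elim: n u => [|n IHn]; elim/BMWt_ind=> [k|u v Su Sv|b i u Su];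
  do ?[exact: stacked_palg | exact: stackedD].
- have -> : i = ord_max by apply: val_inj; case: i => -[].
  elim: Su => [w|w c v|v v' _ IHv _ IHv']; last by rewrite mulrDr; apply: stackedD.
    exact/stacked_mulr/stacked_last1.
  have [k ->] := BMWt0_scalar w; rewrite mulrA; apply: stacked_mulr.
  by rewrite BMWt_incl_palg mulr_palg; apply/stackedZ/stacked_last2.
have [j ->|->] := unliftP ord_max i.
  have -> : sig b (lift ord_max j) = BMWt_incl (sig b j).
    rewrite BMWt_incl_sig; congr (sig _ _); apply: val_inj => /=.
    by rewrite /bump leqNgt ltn_ord.
  exact: stacked_mull.
elim: Su => [w|w c v|v v' _ IHv _ IHv']; last by rewrite mulrDr; apply: stackedD.
  exact/stacked_mulr/stacked_last1.
rewrite mulrA; apply: stacked_mulr; rewrite mulrA.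
(* The factor [w] between the two last generators is stacked by induction: either it comes from two
   strands fewer and commutes with the last generator, or it produces the product of three letters
   of [stacked_last3]. *)
elim: {w}(IHn w) => [w|w d w'|w w' _ IHw _ IHw'].
- rewrite last_sig_commute -mulrA; exact/stacked_mull/stacked_last2.
- rewrite !BMWt_inclM !mulrA last_sig_commute -!mulrA -last_sig_commute.
  rewrite !mulrA; apply: stacked_mulr; rewrite -!mulrA; apply: stacked_mull.
  rewrite mulrA; exact: stacked_last3.
by rewrite BMWt_inclD mulrDr mulrDl; apply: stackedD.
Qed.

(** * Markov traces *)

Section MarkovTrace.
Variables (K : comPzRingType) (A : tower K) (V : lmodType K) (T : forall n, A n -> V).
Hypothesis T_markov : markov_trace T.

Lemma markovD n (u v : A n) : T (u + v) = T u + T v.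
Proof.
have [Tlin _ _ _] := T_markov; have := Tlin n 1 u v.
by rewrite !scale1r.
Qed.
Lemma markov0 n : T (0 : A n) = 0.
Proof.
by have E := markovD (0 : A n) 0; apply: (addrI (T (0 : A n))); rewrite -E !addr0.
Qed.
Lemma markovZ n k (u : A n) : T (palg k * u) = k *: T u.
Proof.
by have [Tlin _ _ _] := T_markov; have := Tlin n k u 0; rewrite /= markov0 !addr0.
Qed.
End MarkovTrace.

Section MarkovClosure.
Variables (K : comPzRingType) (A : tower K) (V W : lmodType K).

Lemma markov_comp (T : forall n, A n -> V) (phi : V -> W) :
  linear phi -> markov_trace T -> markov_trace (fun n u => phi (T n u)).
Proof.
move=> phi_lin [Tlin TC Tp Tm]; split=> [n k u v|n u v|n u|n u].
- by rewrite Tlin phi_lin.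
- by rewrite TC.
- by rewrite Tp.
by rewrite Tm.
Qed.

Lemma markov_sub (T T' : forall n, A n -> V) :
  markov_trace T -> markov_trace T' -> markov_trace (fun n u => T n u - T' n u).
Proof.
move=> [Tlin TC Tp Tm] [Tlin' TC' Tp' Tm']; split=> [n k u v|n u v|n u|n u].
- by rewrite Tlin Tlin' scalerBr opprD addrACA.
- by rewrite TC TC'.
- by rewrite Tp Tp'.
by rewrite Tm Tm'.
Qed.
End MarkovClosure.

(* delta n = s_1 s_2 ... s_n, of inverse deltaV n *)
Fixpoint delta n : BMWt n :=
  if n is m.+1 then BMWt_incl (delta m) * last_sig m false else 1.
Fixpoint deltaV n : BMWt n :=
  if n is m.+1 then last_sig m true * BMWt_incl (deltaV m) else 1.

Lemma deltaS n : delta n.+1 = BMWt_incl (delta n) * last_sig n false.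
Proof. by []. Qed.

Lemma deltaK n : delta n * deltaV n = 1.
Proof.
elim: n => [|n IHn]; first by rewrite mulr1.
rewrite /= -mulrA [last_sig _ _ * (_ * _)]mulrA (last_sigK _ false) mul1r.
by rewrite -BMWt_inclM IHn BMWt_incl1.
Qed.
Lemma deltaVK n : deltaV n * delta n = 1.
Proof.
elim: n => [|n IHn]; first by rewrite mulr1.
rewrite /= -mulrA [BMWt_incl _ * (_ * _)]mulrA -BMWt_inclM IHn BMWt_incl1 mul1r.
exact: (last_sigK _ true).
Qed.

Lemma sig_lift_max n b (j : 'I_n) : sig b (lift ord_max j) = BMWt_incl (sig b j).
Proof.
rewrite BMWt_incl_sig; congr sig; apply: val_inj => /=.
by rewrite /bump leqNgt ltn_ord.
Qed.
Lemma lift0_max n : lift ord0 (@ord_max n) = ord_max.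
Proof. exact: val_inj. Qed.

(** Peel the last factor off [delta]. A generator below the last admissible index commutes with this
    factor and is handled by induction; for the last index, the braid relation applies, and the
    remaining initial part of [delta] commutes with the new generator. *)
Lemma delta_sig n b (i : 'I_n) :
  intertwines (delta n.+1) (BMWt_incl (sig b i)) (sig b (lift ord0 i)).
Proof.
elim: n => [|n IHn] in b i *; first by case: i.
suff dS0 : intertwines (delta n.+2) (BMWt_incl (sig false i)) (sig false (lift ord0 i)).
  case: b; last exact: dS0.
  apply: intertwinesV dS0; last exact: (sigK true).
  by rewrite -BMWt_inclM (sigK false) BMWt_incl1.
have [j ->|->] := unliftP ord_max i.
  have -> : lift ord0 (lift ord_max j) = lift ord_max (lift ord0 j).
    by apply: val_inj; rewrite /= /bump !leq0n !add1n addnS ltnS.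
  rewrite !sig_lift_max /intertwines.
  rewrite (deltaS n.+1) -mulrA last_sig_commute !mulrA -!BMWt_inclM.
  by rewrite (IHn false j : delta _ * _ = _ * delta _).
rewrite lift0_max -/(last_sig n false) -/(last_sig n.+1 false) /intertwines.
have near := last_near n; rewrite /= in near.
rewrite (deltaS n.+1) (deltaS n) BMWt_inclM -!mulrA.
rewrite [BMWt_incl _ * (last_sig _ _ * _)]mulrA near.
by clear near; rewrite !mulrA -(last_sig_commute false (delta n)).
Qed.

(** * Vanishing of a Markov trace that is zero at 1 on one and two strands *)

Section Vanishing.
Variables (V : lmodType ringR) (T : forall n, BMWt n -> V).
Hypotheses (T_markov : markov_trace (A := BMWt_tower) (V := V) T)
  (reg : forall v : V, (Rx ^+ 2 * Ry * (Ry - Ra ^+ 2)) *: v = 0 -> v = 0)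
  (T0 : T (1 : BMWt 0) = 0) (T1 : T (1 : BMWt 1) = 0).

Let traceD n (u v : BMWt n) : T (u + v) = T u + T v := markovD T_markov u v.
Let traceZ n k (u : BMWt n) : T (palg k * u) = k *: T u := markovZ T_markov k u.
Lemma traceC n (u v : BMWt n) : T (u * v) = T (v * u).
Proof. by have [_ TC _ _] := T_markov; apply: TC. Qed.
Lemma trace_last n b (u : BMWt n) : T (BMWt_incl u * last_sig n b) = T u.
Proof.
have [_ _ Tp Tm] := T_markov; rewrite /last_sig /sig bmw_brE.
by case: b; [apply: Tm | apply: Tp].
Qed.

Section Step.
Variable n : nat.
Hypothesis Tn : forall u : BMWt n.+1, T u = 0.

(* Conjugate by delta: the last factor becomes the last generator. *)
Lemma trace_last_pair b (w : BMWt n) :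
  T (BMWt_incl (BMWt_incl w) * BMWt_incl (last_sig n b)) = 0.
Proof.
(* The witness is the shift of [w]: each generator is moved one place further, which still stays
   below the last one. *)
have [v dv] : exists v : BMWt n.+1,
    intertwines (delta n.+2) (BMWt_incl (BMWt_incl w)) (BMWt_incl v).
  elim/BMWt_ind: w => [k|u u' [v dv] [v' dv']|c i u [v dv]].
  - by exists (palg k); rewrite !BMWt_incl_palg; apply: intertwines_palg.
  - by exists (v + v'); rewrite !BMWt_inclD; apply: intertwinesD.
  exists (sig c (lift ord0 i) * v); rewrite !BMWt_inclM; apply: intertwinesM dv.
  rewrite (_ : BMWt_incl (sig c (lift ord0 i)) =
      sig c (lift ord0 (widen_ord (leqnSn n) i))).
    by rewrite [in X in intertwines _ X]BMWt_incl_sig; apply: delta_sig.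
  by rewrite BMWt_incl_sig; congr sig; apply: val_inj.
have dl := delta_sig b (@ord_max n); rewrite lift0_max in dl.
have E : delta n.+2 * (BMWt_incl (BMWt_incl w) * BMWt_incl (last_sig n b)) =
    BMWt_incl v * last_sig n.+1 b * delta n.+2.
  exact: intertwinesM dv dl.
rewrite -[X in T X]mul1r -(deltaVK n.+2) -mulrA E traceC -mulrA deltaK mulr1 trace_last.
exact: Tn.
Qed.

(** Apply [trace_bmw_elt] with B the image of [w]; [reg] cancels the resulting scalar. *)
Lemma trace_incl2 (w : BMWt n) : T (BMWt_incl (BMWt_incl w)) = 0.
Proof.
apply: reg.
have Tu b (u : BMWt n.+1) : T (BMWt_incl u * last_sig n.+1 b) = 0.
  by rewrite trace_last Tn.
(* A word with a single last generator can be rotated until that letter stands at the end, where the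
   Markov property removes it. *)
have Tsrs b c d : T (BMWt_incl (BMWt_incl w) * (BMWt_incl (last_sig n b)
    * last_sig n.+1 c * BMWt_incl (last_sig n d))) = 0.
  by rewrite !mulrA traceC !mulrA -!BMWt_inclM Tu.
have Trs b c : T (BMWt_incl (BMWt_incl w)
    * (last_sig n.+1 b * BMWt_incl (last_sig n c))) = 0.
  by rewrite mulrA traceC mulrA -BMWt_inclM Tu.
have s2 : BMWt_incl (last_sig n false) * BMWt_incl (last_sig n false) =
    palg (Ra + Rx) * BMWt_incl (last_sig n false) - palg (Ra * Rx + Ry)
    + palg (Ra * Ry) * BMWt_incl (last_sig n true).
  by rewrite -BMWt_inclM last_square !BMWt_inclD BMWt_inclN !BMWt_inclM !BMWt_incl_palg.
have near := nearV (incl_last_sigK n false) (incl_last_sigK n true)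
  (last_sigK n.+1 false) (last_sigK n.+1 true) (last_near n).
exact: (trace_bmw_elt (@traceD n.+2) (@traceZ n.+2) (@traceC n.+2) near
  (last_bmw n) s2 (last_squareV n.+1) (last_sig_commute true w)
  (trace_last_pair false w) (trace_last_pair true w) (Tu false _) (Tu true _)
  (Tsrs _ _ _) (Tsrs _ _ _) (Tsrs _ _ _) (Trs _ _) (Trs _ _)).
Qed.

(** Decompose by [stackedP], and decompose once more the terms free of the last generator; each
    piece is then covered by the Markov property or by the two preceding lemmas. *)
Lemma trace_step (u : BMWt n.+2) : T u = 0.
Proof.
elim: (stackedP u) => [v|v b v'|v v' _ IHv _ IHv'].
- elim: (stackedP v) => [w|w b w'|w w' _ IHw _ IHw'].
  + exact: trace_incl2.
  + rewrite !BMWt_inclM traceC mulrA -!BMWt_inclM [BMWt_incl (_ * _)]BMWt_inclM.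
    exact: trace_last_pair.
  by rewrite BMWt_inclD traceD IHw IHw' addr0.
- by rewrite traceC mulrA -BMWt_inclM trace_last Tn.
by rewrite traceD IHv IHv' addr0.
Qed.
End Step.

Lemma trace_eq0 n (u : BMWt n) : T u = 0.
Proof.
have palg0 m k : T (1 : BMWt m) = 0 -> T (palg k : BMWt m) = 0.
  by move=> T1m; rewrite -[palg k]mulr1 traceZ T1m scaler0.
have Tu0 (v : BMWt 0) : T v = 0.
  by have [k ->] := BMWt0_scalar v; apply: palg0.
(* [trace_step] starts at three strands, that is at [BMWt 2]; on two strands the span consists of
   scalars and of terms reducible to one strand. *)
elim: n u => // -[|n] IHn; last exact: trace_step.
move=> u; elim: (stackedP u) => [v|v b v'|v v' _ IHv _ IHv'].
- by have [k ->] := BMWt0_scalar v; rewrite BMWt_incl_palg; apply: palg0.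
- by rewrite traceC mulrA -BMWt_inclM trace_last Tu0.
by rewrite traceD IHv IHv' addr0.
Qed.
End Vanishing.

(** * Values on two strands *)

Lemma ideal_principal (A : comPzRingType) (g v : A) :
  ideal (fun u => u = g) v -> exists c, v = c * g.
Proof.
elim=> [u ->||u w _ [c ->] _ [d ->]|u w _ [c ->]|u w _ [c ->]].
- by exists 1; rewrite mul1r.
- by exists 0; rewrite mul0r.
- by exists (c + d); rewrite mulrDl.
- by exists (u * c); rewrite mulrA.
by exists (w * c); rewrite mulrC mulrA.
Qed.

(** Write 2 y v = (a + y) v - (a - y) v and substitute one factorization of v in each term. *)
Lemma crt_principal (A : comPzRingType) (a y k c d v : A) : k * (y + y) = 1 ->
  v = c * (a - y) -> v = d * (a + y) -> v = k * (c - d) * (a ^+ 2 - y ^+ 2).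
Proof.
move=> kE vc vd; rewrite -[LHS]mul1r -kE.
have -> : k * (y + y) * v = k * ((a + y) * v - (a - y) * v) by ring.
by rewrite {1}vc vd; ring.
Qed.

Lemma R2_unit : exists k : ringR, k * (Ry + Ry) = 1.
Proof.
have [k kE] := Ry_unit.
have [h hE] : exists h : ringR, h * (1 + 1) = 1.
  exists (loc_in abc (mpolyC 3 (2^-1))).
  rewrite -(rmorph1 (loc_in abc)) -(rmorphD (loc_in abc)) -(rmorphM (loc_in abc)).
  congr (loc_in abc _); rewrite -(mpolyC1 3 rat) -mpolyCD -mpolyCM.
  by congr mpolyC.
exists (h * k); rewrite -[X in X + _]mul1r -[X in _ + X]mul1r -mulrDl.
by rewrite mulrACA hE kE mulr1.
Qed.

(** Injectivity of the Chinese remainder map, which holds because 2 y is a unit. It allows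
    identities in [ringSbar] to be checked on the two signs. *)
Lemma Sbar_crt (p q : ringS) :
  (forall sg, StoSpm sg p = StoSpm sg q) -> StoSbar p = StoSbar q.
Proof.
move=> pq; apply/quot_eqP.
have [k kE] := R2_unit.
have [c vc] := ideal_principal (proj1 (quot_eqP _ _ _) (pq false)).
have [d vd] := ideal_principal (proj1 (quot_eqP _ _ _) (pq true)).
rewrite expr0 mul1r in vc; rewrite expr1 mulN1r opprK in vd.
have kE' : RtoS k * (RtoS Ry + RtoS Ry) = 1.
  by rewrite -(rmorphD RtoS) -(rmorphM RtoS) kE (rmorph1 RtoS).
rewrite (crt_principal kE' vc vd); apply: idealMl; apply: ideal_gen.
by rewrite /Sbar_rel (rmorphB RtoS) !(rmorphXn RtoS).
Qed.

(** The factor 1 on the left gives the shape required by [markovZ]. *)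
Lemma hecke_skein :
  let s : heckeH 1 := hecke_pi (gelt ringR (artin ord_max)) in
  let r : heckeH 1 := hecke_pi (gelt ringR (artin ord_max)^-1%g) in
  palg Rx * 1 = s + palg Ry * r.
Proof.
move=> s r.
have sr : s * r = 1.
  rewrite /s /r /hecke_pi -(rmorphM (quot_pi (@hecke_rel 1))).
  rewrite /gelt gmonM mulgV mulr1 -/(gelt _ _) gelt1.
  exact: (rmorph1 (quot_pi (@hecke_rel 1))).
have s2 : (s - palg Rb) * (s - palg Rc) = 0.
  pose s0 : braid_alg 1 := gelt ringR (artin ord_max).
  have E : hecke_pi ((s0 - palg Rb) * (s0 - palg Rc)) = 0.
    have -> : hecke_pi ((s0 - palg Rb) * (s0 - palg Rc)) = hecke_pi 0.
      by apply/quot_eqP; rewrite subr0; apply: ideal_gen; exists ord_max.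
    exact: (rmorph0 (quot_pi (@hecke_rel 1))).
  rewrite -[RHS]E /hecke_pi (rmorphM (quot_pi (@hecke_rel 1))).
  by rewrite !(rmorphB (quot_pi (@hecke_rel 1))).
by rewrite mulr1; apply: quadratic_skein.
Qed.

(** Take the trace of [hecke_skein]: both Markov properties send the generator and its inverse to
    the value 1 on one strand. *)
Lemma ocneanu_value tH : ocneanu_trace tH ->
  RtoS Rx * tH 1%N 1 = 1 + RtoS Ry.
Proof.
case=> _ tH0 [th thM thE].
have thE1 n : tH n 1 = th n 1.
  by have := thE n 1; rewrite H_pi1 BMWt_pi1 => ->; congr (th n _).
have th0 : th 0%N 1 = 1 by rewrite -thE1.
have [_ _ Tp Tm] := thM.
have i1 : hecke_incl (1 : heckeH 0) = 1 by apply: (rmorph1 (@hecke_incl 0)).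
have hp := Tp 0%N 1; have hm := Tm 0%N 1.
rewrite /= i1 !mul1r th0 in hp hm.
rewrite thE1; transitivity (th 1%N (palg Rx * 1)).
  by symmetry; apply: (markovZ thM Rx).
rewrite hecke_skein (markovD thM) (markovZ thM) hp hm.
exact: (congr1 (fun u : ringS => 1 + u) (mulr1 _)).
Qed.

Lemma StoSbar_surj (u : ringSbar) : exists p, u = StoSbar p.
Proof. by exists (quot_repr u); rewrite -[LHS]quot_reprK. Qed.

Lemma Spm_a sg : RtoSpm sg Ra = (-1) ^+ sg * RtoSpm sg Ry.
Proof.
apply/eqP; rewrite -subr_eq0; apply/eqP.
transitivity (StoSpm sg (RtoS Ra - (-1) ^+ sg * RtoS Ry)).
  by rewrite (rmorphB (StoSpm sg)) (rmorphM (StoSpm sg)) (rmorph_sign (StoSpm sg)).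
rewrite -(rmorph0 (StoSpm sg)); apply/quot_eqP; rewrite subr0; exact: ideal_gen.
Qed.

(** Here [k] is 1 / y, so a / y is the element whose components are the two signs; it encodes the
    sign uniformly in [ringSbar]. *)
Lemma Spm_aVy sg k : k * Ry = 1 -> RtoSpm sg (k * Ra) = (-1) ^+ sg.
Proof.
move=> kE; transitivity (RtoSpm sg k * RtoSpm sg Ra); first exact: rmorphM.
rewrite Spm_a mulrCA -[RHS]mulr1; congr (_ * _).
by rewrite -(rmorph1 (RtoSpm sg)) -kE; symmetry; apply: (rmorphM (RtoSpm sg)).
Qed.

Section KauffmanValues.
Variables (tK : forall n, BMWt n -> ringSbar).
Hypothesis tK_kauffman : kauffman_trace tK.

Let tK_comp n p : StoSbar p = tK (1 : BMWt n) -> forall sg,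
  exists2 tpm : forall n, BMWpm sg n -> ringSpm sg, kauffman_trace_pm tpm
    & StoSpm sg p = tpm n 1.
Proof.
have [_ [tpm tpmP tpmE]] := tK_kauffman.
move=> pE sg; exists (tpm sg) => //; rewrite -SbartoSpmE pE.
by have := tpmE sg n 1; rewrite BMWt_pi1.
Qed.

Lemma kauffman_value0 : tK (1 : BMWt 0) = 1.
Proof.
have [p pE] := StoSbar_surj (tK (1 : BMWt 0)).
rewrite pE -(rmorph1 StoSbar); apply: Sbar_crt => sg.
have [tpm [_ tpm1 _] ->] := tK_comp (esym pE) sg.
by rewrite tpm1 (rmorph1 (StoSpm sg)).
Qed.

(** Each component (y -+ x + 1) / x equals (1 + y) / x minus the sign, and the sign is a / y by
    [Spm_aVy]; [h] is (1 + y) / x. *)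
Lemma kauffman_value1 (h : ringS) (k : ringR) :
  RtoS Rx * h = 1 + RtoS Ry -> k * Ry = 1 ->
  tK (1 : BMWt 1) = StoSbar h - RtoSbar (k * Ra).
Proof.
move=> hE kE; have [p pE] := StoSbar_surj (tK (1 : BMWt 1)).
rewrite pE -[RtoSbar _]/(StoSbar (RtoS (k * Ra))) -(rmorphB StoSbar).
apply: Sbar_crt => sg.
have [tpm [_ _ tpm1] ->] := tK_comp (esym pE) sg.
rewrite tpm1 (rmorphB (StoSpm sg)) -[StoSpm sg (RtoS _)]/(RtoSpm sg (k * Ra)).
rewrite (Spm_aVy sg kE).
have xE : RtoSpm sg Rx * StoSpm sg xinv = 1.
  rewrite -[RtoSpm sg Rx]/(StoSpm sg (RtoS Rx)) -(rmorphM (StoSpm sg)).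
  by rewrite -(rmorph1 (StoSpm sg)); congr (StoSpm sg _); apply: loc_inV.
have hx : h = (1 + RtoS Ry) * xinv.
  by rewrite -hE mulrAC -[LHS]mul1r; congr (_ * _); symmetry; apply: loc_inV.
rewrite hx (rmorphM (StoSpm sg)) (rmorphD (StoSpm sg)) (rmorph1 (StoSpm sg)).
rewrite -[StoSpm sg (RtoS Ry)]/(RtoSpm sg Ry) addrAC mulrBl [_ + 1]addrC.
by congr (_ - _); rewrite -mulrA xE mulr1.
Qed.
End KauffmanValues.

(** * Combining the two known traces *)

Lemma RtoLM (u v : ringR) : RtoL (u * v) = RtoL u * RtoL v.
Proof. exact: (rmorphM RtoL). Qed.

Lemma inv_prod (K : comPzRingType) (x x' y y' a a' : K) :
  x * x' = 1 -> y * y' = 1 -> a * a' = 1 ->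
  - (x' ^+ 2 * y' * a') * (x ^+ 2 * y * - a) = 1.
Proof.
move=> xx' yy' aa'; transitivity ((x * x') ^+ 2 * (y * y') * (a * a')); first by ring.
by rewrite xx' yy' aa' expr1n !mulr1.
Qed.

(** Each of x, y and a^2 - y is invertible in [ringL]. This is where the localization at a^2 - y
    enters: it makes [reg] hold on the target module. *)
Lemma RtoL_unit : exists w : ringL, w * RtoL (Rx ^+ 2 * Ry * (Ry - Ra ^+ 2)) = 1.
Proof.
have [k kE] := Ry_unit.
have xE : RtoL Rx * SbartoL (StoSbar xinv) = 1.
  transitivity (SbartoL (StoSbar (RtoS Rx * xinv))).
    by rewrite (rmorphM StoSbar) (rmorphM SbartoL).
  have -> : RtoS Rx * xinv = 1 by apply: loc_inV.
  by rewrite (rmorph1 StoSbar) (rmorph1 SbartoL).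
have yE : RtoL Ry * RtoL k = 1 by rewrite -RtoLM mulrC kE; apply: (rmorph1 RtoL).
have aE : RtoL (Ra ^+ 2 - Ry) * Defs.frac (RtoSbar (Ra ^+ 2 - Ry)) 1 1 = 1.
  exact: loc_inV.
have aE' : RtoL (Ry - Ra ^+ 2) = - RtoL (Ra ^+ 2 - Ry).
  by rewrite -opprB; apply: (rmorphN RtoL).
have -> : RtoL (Rx ^+ 2 * Ry * (Ry - Ra ^+ 2)) =
    RtoL Rx ^+ 2 * RtoL Ry * RtoL (Ry - Ra ^+ 2).
  by rewrite expr2 !RtoLM -expr2.
by rewrite aE'; eexists; apply: inv_prod xE yE aE.
Qed.

(** A linear system of two equations: eliminating [m1] gives h v1 - v2 = (h - k) m2 = e m2, and [e]
    is its own inverse. *)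
Lemma solve_two_values (K : comPzRingType) (V : lmodType K) (e h k : K) (v1 v2 : V) :
  e * e = 1 -> k = h - e ->
  let m2 := e *: (h *: v1 - v2) in let m1 := v1 - m2 in
  v1 = m1 + m2 /\ v2 = h *: m1 + k *: m2.
Proof.
move=> ee -> m2 m1; split; first by rewrite subrK.
rewrite scalerBr scalerBl addrA subrK /m2 scalerA ee scale1r opprB addrC.
by rewrite subrK.
Qed.

Theorem proposition5p8 (M : lmodType ringR) (t : forall n, BMWt n -> M)
    (tH : forall n, BMWt n -> ringS) (tK : forall n, BMWt n -> ringSbar) :
  markov_trace (A := BMWt_tower) (V := M) t ->
  ocneanu_trace tH ->
  kauffman_trace tK ->
  exists m1 m2 : tens RtoL M, forall (n : nat) (beta : BMWt n),
    pure RtoL (t n beta) 1 =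
      SbartoL (StoSbar (tH n beta)) *: m1 + SbartoL (tK n beta) *: m2.
Proof.
move=> t_markov tH_oc tK_kauf.
have [k kE] := Ry_unit.
have h2 := ocneanu_value tH_oc.
have k2 := kauffman_value1 tK_kauf h2 kE.
have k1 := kauffman_value0 tK_kauf.
have [tH_markov h1 _] := tH_oc; have [tK_markov _] := tK_kauf.
pose e := RtoL (k * Ra).
pose v1 := pure RtoL (t 0%N 1) 1; pose v2 := pure RtoL (t 1%N 1) 1.
(* The element a / y squares to 1 because both its components are signs. *)
have ee : e * e = 1.
  rewrite /e -RtoLM -[RtoL _]/(SbartoL (StoSbar (RtoS (k * Ra * (k * Ra))))).
  rewrite -(rmorph1 SbartoL) -(rmorph1 StoSbar); congr (SbartoL _).
  apply: Sbar_crt => sg; rewrite (rmorph1 (StoSpm sg)).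
  rewrite (rmorphM RtoS) (rmorphM (StoSpm sg)).
  rewrite -[StoSpm sg (RtoS _)]/(RtoSpm sg (k * Ra)) (Spm_aVy sg kE).
  by case: sg; rewrite ?expr0 ?expr1 ?mulrNN mulr1.
have k2L : SbartoL (tK 1%N 1) = SbartoL (StoSbar (tH 1%N 1)) - e.
  by rewrite k2 (rmorphB SbartoL).
have [v1E v2E] := solve_two_values v1 v2 ee k2L.
move: v1E v2E; set m2 := e *: _; set m1 := v1 - m2 => v1E v2E.
exists m1, m2 => n beta; apply/eqP; rewrite -subr_eq0 opprD addrA; apply/eqP.
(* Scalars are restricted to R so that the difference [D] is a Markov trace over R, as [trace_eq0]
   demands. *)
pose W : lmodType ringR := restr RtoL (tens RtoL M).
pose D n (u : BMWt n) : W := pure RtoL (t n u) 1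
  - SbartoL (StoSbar (tH n u)) *: m1 - SbartoL (tK n u) *: m2.
have D_markov : markov_trace (A := BMWt_tower) (V := W) D.
  apply: (markov_sub (A := BMWt_tower) (V := W));
    first apply: (markov_sub (A := BMWt_tower) (V := W)).
  - apply: (markov_comp (A := BMWt_tower)
      (phi := fun v : M => pure RtoL v 1 : W)) t_markov.
    move=> r u v; rewrite pureDl pureZ; congr (_ + _).
    by symmetry; apply: tens_scaleE.
  - apply: (markov_comp (A := BMWt_tower) (V := restr RtoS ringS^o)
      (phi := fun v : ringS => SbartoL (StoSbar v) *: m1 : W)) tH_markov.
    move=> r u v; change (SbartoL (StoSbar (RtoS r * u + v)) *: m1 =
      RtoL r *: (SbartoL (StoSbar u) *: m1) + SbartoL (StoSbar v) *: m1).
    rewrite scalerA -scalerDl; congr (_ *: _).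
    by rewrite (rmorphD StoSbar) (rmorphM StoSbar) (rmorphD SbartoL) (rmorphM SbartoL).
  apply: (markov_comp (A := BMWt_tower) (V := restr RtoSbar ringSbar^o)
    (phi := fun v : ringSbar => SbartoL v *: m2 : W)) tK_markov.
  move=> r u v; change (SbartoL (RtoSbar r * u + v) *: m2 =
    RtoL r *: (SbartoL u *: m2) + SbartoL v *: m2).
  rewrite scalerA -scalerDl; congr (_ *: _).
  by rewrite (rmorphD SbartoL) (rmorphM SbartoL).
have [w wE] := RtoL_unit.
apply: (trace_eq0 (V := W) (T := D) D_markov) => [v vE||].
(* Injectivity of the scalar comes from its inverse [w]; the two remaining goals are the equations
   that define [m1] and [m2]. *)
- rewrite -[LHS](scale1r (v : tens RtoL M)) -wE -scalerA.
  exact: (etrans (congr1 _ vE) (scaler0 _ w)).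
- rewrite /D h1 k1 (rmorph1 StoSbar) (rmorph1 SbartoL) !scale1r -/v1.
  by rewrite [in LHS]v1E addrAC addrK subrr.
by rewrite /D -/v2 [in LHS]v2E addrAC addrK subrr.
Qed.
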